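(* Let $d\ge 2$ and consider a random walk in an elliptic i.i.d. random environment on $\mathbb{Z}^d$. Fix $\ell\in S^{d-1}$ and assume that the random walk is transient in the direction $\ell$. If $$\max_{x\in\mathfrak{H}}\mathbb{E}_x\bigl[T^{\mathrm{ex}}_{\mathfrak{H}}\bigr]=\infty ,$$ then the walk has zero speed, i.e. $v=\lim_{n\to\infty}X_n/n=\vec 0$, $\mathbb{P}$-almost surely.
   Context: Setting. $U$ is the set of the $2d$ canonical unit vectors of $\mathbb{Z}^d$, and $\mathcal{P}=\{(p(e))_{e\in U}: p(e)\ge 0,\ \sum_{e\in U}p(e)=1\}$. An environment is $\omega\in\Omega=\mathcal{P}^{\mathbb{Z}^d}$, i.e. a family of transition probabilities $p^\omega(x,\cdot)=(p^\omega(x,e))_{e\in U}$, $x\in\mathbb{Z}^d$. The quenched law $P^\omega_x$ is the law of the Markov chain $(X_n)_{n\ge0}$ on $\mathbb{Z}^d$ with $P_x^\omega[X_0=x]=1$ and $P_x^\omega[X_{n+1}=y+e\mid X_n=y]=p^\omega(y,e)$. The environment has law $\mathbf{P}$, a probability measure on $\Omega$ under which the $p^\omega(x,\cdot)$, $x\in\mathbb{Z}^d$, are i.i.d. The annealed law is $\mathbb{P}_x=\int P^\omega_x\,d\mathbf{P}$, with expectation $\mathbb{E}_x$, and $\mathbb{P}=\mathbb{P}_0$. The environment is elliptic if $\mathbf{P}$-a.s. $p^\omega(x,e)>0$ for all $x\in\mathbb{Z}^d$, $e\in U$. The walk is transient in the direction $\ell\in S^{d-1}$ (Euclidean unit sphere)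 if $\mathbb{P}[\lim_{n\to\infty} X_n\cdot\ell=\infty]=1$. It is known that for an elliptic i.i.d. environment, transience in a direction $\ell$ implies that $X_n/n$ converges $\mathbb{P}$-a.s. to a deterministic limit $v$. Given $\ell$, enumerate $U$ so that $e_1,\dots,e_d$ is an orthonormal basis of $\mathbb{Z}^d$ with $e_1\cdot\ell\ge e_2\cdot\ell\ge\dots\ge e_d\cdot\ell\ge0$, and $e_{i+d}=-e_i$ for $1\le i\le d$. The unit hypercube is $\mathfrak{H}=\{\sum_{i=1}^d\epsilon_ie_i:\ \epsilon_i\in\{0,1\}\}$. For $A\subset\mathbb{Z}^d$, $T_A^{\mathrm{ex}}=\inf\{n\ge0: X_n\notin A\}$. *)

(* Defs.v *)
From HB Require Import structures.
From mathcomp Require Import all_boot all_order all_algebra.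
From mathcomp Require Import all_classical all_reals all_analysis.
Set Implicit Arguments.
Unset Strict Implicit.
Unset Printing Implicit Defensive.
Import Order.TTheory GRing.Theory Num.Theory.
Import numFieldNormedType.Exports.
Local Open Scope classical_set_scope.
Local Open Scope ring_scope.

HB.instance Definition _ := isPointed.Build int 0.

Notation lattice d := 'rV[int]_d.

(* The 2d canonical unit vectors, as signed coordinate directions. *)
Notation direction d := ('I_d * bool)%type.

Definition vec_of (d : nat) (e : direction d) : lattice d :=
  (-1) ^+ e.2 *: delta_mx 0 e.1.

Definition dot (R : pzRingType) (d : nat) (u v : 'rV[R]_d) : R :=
  \sum_(k < d) u 0 k * v 0 k.

Definition realvec (R : pzRingType) (d : nat) (x : lattice d) : 'rV[R]_d :=
  map_mx intr x.

Section environment.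
Context (R : realType).

Record simplex (d : nat) : Type := Simplex {
  simplex_fun :> direction d -> R ;
  simplex_ge0 : forall e, 0 <= simplex_fun e ;
  simplex_sum1 : \sum_e simplex_fun e = 1 }.

HB.instance Definition _ d := gen_eqMixin (simplex d).
HB.instance Definition _ d := gen_choiceMixin (simplex d).

(* Measurable types are pointed, and the simplex is empty in dimension 0;
   from here on the dimension is d.+1. *)
Context (d : nat).

Let first_dir (e : direction d.+1) : R := (e == (ord0, false))%:R.

Let first_dir_ge0 e : 0 <= first_dir e. Proof. exact: ler0n. Qed.

Let first_dir_sum1 : \sum_e first_dir e = 1.
Proof.
rewrite (bigD1 (ord0, false)) //= /first_dir eqxx big1 ?addr0 // => e.
by move/negbTE->.
Qed.

HB.instance Definition _ :=
  isPointed.Build (simplex d.+1) (Simplex first_dir_ge0 first_dir_sum1).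

Definition simplex_cylinders : set (set (simplex d.+1)) :=
  [set C | exists (e : direction d.+1) (B : set R),
     measurable B /\ C = [set p : simplex d.+1 | B (p e)]].

Notation site := (g_sigma_algebraType simplex_cylinders).

Definition env_cylinders : set (set (lattice d.+1 -> site)) :=
  [set C | exists (x : lattice d.+1) (A : set site),
     measurable A /\ C = [set w | A (w x)]].

End environment.

Notation site R d := (g_sigma_algebraType (@simplex_cylinders R d)).
Notation env R d := (g_sigma_algebraType (@env_cylinders R d)).

(* The lattice is countable, so these sets generate the product of the
   discrete sigma-algebras. *)
Definition traj_cylinders (d : nat) : set (set (nat -> lattice d)) :=
  [set C | exists n y, C = [set X | X n = y]].

Notation traj d := (g_sigma_algebraType (@traj_cylinders d)).

Section random_walk.
Context (R : realType) (d : nat).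
Implicit Types (P : probability (env R d) R) (w : env R d)
  (x y : lattice d.+1) (e : direction d.+1).

Definition trans w x e : R := (w x : simplex R d.+1) e.

Definition iid P : Prop :=
  (forall x (A : set (site R d)), measurable A ->
     P [set w | A (w x)] = P [set w | A (w 0)]) /\
  (forall (s : seq (lattice d.+1)) (A : lattice d.+1 -> set (site R d)),
     uniq s -> (forall x, measurable (A x)) ->
     P [set w | forall x, x \in s -> A x (w x)] =
     (\prod_(x <- s) P [set w | A x (w x)])%E).

Definition elliptic P : Prop :=
  {ae P, forall w, forall x e, 0 < trans w x e}.

(* The law of the Markov chain with transition probabilities w started at x:
   the conditional probability of the next step given the past is stated in
   multiplied-out form, so that it also makes sense for null pasts. *)
Definition markov_law w x (mu : set (traj d.+1) -> \bar R) : Prop :=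
  mu [set X | X 0%N = x] = 1%E /\
  (forall (n : nat) (s : nat -> lattice d.+1) e,
     mu [set X | (forall i, (i <= n)%N -> X i = s i) /\
                 X n.+1 = s n + vec_of e] =
     ((trans w (s n) e)%:E *
      mu [set X | forall i, (i <= n)%N -> X i = s i])%E).

Definition quenched_law (Q : lattice d.+1 -> R.-pker (env R d) ~> (traj d.+1))
    : Prop :=
  forall x w, markov_law w x (Q x w).

Section annealed.
Context (P : probability (env R d) R) (K : R.-pker (env R d) ~> (traj d.+1)).

Definition annealed (A : set (traj d.+1)) : \bar R := (\int[P]_w K w A)%E.

Let annealed0 : annealed set0 = 0%E.
Proof. by apply: integral0_eq => w _; rewrite measure0. Qed.

Let annealed_ge0 A : (0 <= annealed A)%E.
Proof. by apply: integral_ge0 => w _; exact: measure_ge0. Qed.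

Let annealed_sigma_additive : semi_sigma_additive annealed.
Proof.
move=> F mF tF mUF; rewrite [X in _ --> X](_ : _ =
    \int[P]_w (\sum_(0 <= k <oo) K w (F k)))%E; last first.
  apply: eq_integral => w _.
  by apply/esym/cvg_lim => //; exact: measure_semi_sigma_additive.
rewrite integral_nneseries//.
- apply: is_cvg_ereal_nneg_natsum => n _.
  exact: annealed_ge0.
- by move=> n; exact: measurable_kernel.
Qed.

HB.instance Definition _ := isMeasure.Build _ _ _ annealed
  annealed0 annealed_ge0 annealed_sigma_additive.

Let annealed_setT : annealed setT = 1%E.
Proof.
rewrite /annealed; under eq_integral do rewrite prob_kernel /=.
rewrite integral_cst// mul1e; exact: probability_setT.
Qed.

HB.instance Definition _ :=
  Measure_isProbability.Build _ _ _ annealed annealed_setT.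

End annealed.

(* +oo if the trajectory never leaves A *)
Definition exit_time (A : set (lattice d.+1)) (X : traj d.+1) : \bar R :=
  ereal_inf [set n%:R%:E | n in [set n | ~ A (X n)]].

Definition transient (mu : set (traj d.+1) -> \bar R) (l : 'rV[R]_d.+1)
    : Prop :=
  mu [set X | dot (realvec R (X n)) l @[n --> \oo] --> +oo] = 1%E.

(* b enumerates e_1, ..., e_d; the other unit vectors are their opposites. *)
Definition adapted_basis (l : 'rV[R]_d.+1) (b : 'I_d.+1 -> direction d.+1)
    : Prop :=
  [/\ (forall i j, dot (vec_of (b i)) (vec_of (b j)) = (i == j)%:R),
      (forall i j : 'I_d.+1, (i <= j)%N ->
         dot (realvec R (vec_of (b j))) l <= dot (realvec R (vec_of (b i))) l)
    & (forall i, 0 <= dot (realvec R (vec_of (b i))) l)].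

Definition hypercube (b : 'I_d.+1 -> direction d.+1) : set (lattice d.+1) :=
  range (fun eps : {ffun 'I_d.+1 -> bool} =>
           \sum_i (eps i)%:R *: vec_of (b i)).

End random_walk.

(* Main.v *)
Require Import Defs.
From HB Require Import structures.
From mathcomp Require Import all_boot all_order all_algebra.
From mathcomp Require Import all_classical all_reals all_analysis.
From mathcomp Require Import measurable_realfun.
From mathcomp Require Import ring lra zify.
Import Order.TTheory GRing.Theory Num.Theory.
Import numFieldNormedType.Exports.
Local Open Scope classical_set_scope.
Local Open Scope ring_scope.
Set Implicit Arguments.
Unset Strict Implicit.
Unset Printing Implicit Defensive.

(** Why the walk has zero speed.  Fix a coordinate direction u and watch the
    times at which the walk first reaches the levels 0, 3, 6, ... along u.  When
    a new level is reached at a point y, nothing on that level or beyond has been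
    used yet, so the environment ahead is an independent fresh copy.  There the
    walk has the chance of taking one step along u and one sideways step that
    carries it into a translate of the unit hypercube at the very point from
    which the hypercube has infinite mean exit time; this translate lies between
    the levels of y and y + 2u.  The two prescribed steps start outside the
    translate, so their probabilities are independent of the time spent inside.
    Hence every passage of three levels costs an independent time of infinite
    mean, uniformly in y, and the walk needs more than C k steps to climb 3 k
    levels, for every C and all large k.  Applied to all 2 d coordinate
    directions, this gives X_n / n -> 0.

    Quantitatively, let 0 < s <= 1 and let T_k be the time at which level 3 k
    along u is reached.  A fresh passage has discounted quenched mean at most
      1 - (1 - s) * (probability of the two steps)
          * (sum over t < M of s ^ t * P[still in the hypercube after t steps]),
    whose annealed mean is mean_delay; by independence the annealed mean of
    s ^ T_k is at most mean_delay ^ k (mean_exit_disc_le), and Markov's inequality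
    gives P[T_k <= C k] <= (mean_delay / s ^ C) ^ k (mean_exit_le).  As the sum of
    the annealed probabilities of staying in the hypercube diverges, M large and
    s close to 1 make this ratio smaller than 1 (discount_beats_power), and the
    Borel-Cantelli lemma concludes (infinite_mean_slows_direction).

    All quenched quantities involved only look at finitely many steps, so that
    they are polynomials in the entries of the environment.  For these,
    independence and stationarity are read off from monomials
    (mean_env_polyM, mean_env_poly_shift), and the strong Markov property becomes
    an induction on the time horizon (exit_disc_strong_markov,
    mean_discounted_exit_fresh). *)

(** * Quenched quantities with a finite time horizon *)

Section quenched_functionals.
Context (R : realType) (d : nat).
Implicit Types (w : env R d) (x y z c : lattice d.+1) (e f u : direction d.+1).
Implicit Types (A B : set (lattice d.+1)) (g : lattice d.+1 -> env R d -> R).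

Lemma trans_ge0 w z e : 0 <= trans w z e.
Proof. exact: simplex_ge0. Qed.

Lemma trans_sum1 w z : \sum_e trans w z e = 1.
Proof. exact: simplex_sum1. Qed.

Lemma trans_le1 w z e : trans w z e <= 1.
Proof.
rewrite -(trans_sum1 w z) (bigD1 e)//= lerDl; apply: sumr_ge0 => i _.
exact: trans_ge0.
Qed.

Definition step_mean w z (h : lattice d.+1 -> R) : R :=
  \sum_e trans w z e * h (z + vec_of e).

Lemma step_mean_le w z (h k : lattice d.+1 -> R) :
  (forall e, h (z + vec_of e) <= k (z + vec_of e)) ->
  step_mean w z h <= step_mean w z k.
Proof.
move=> hk; apply: ler_sum => e _; apply: ler_wpM2l => //; exact: trans_ge0.
Qed.

Lemma step_mean_cst w z (a : R) : step_mean w z (fun=> a) = a.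
Proof. by rewrite /step_mean -mulr_suml trans_sum1 mul1r. Qed.

Lemma step_meanB w z (h k : lattice d.+1 -> R) :
  step_mean w z (fun y => h y - k y) = step_mean w z h - step_mean w z k.
Proof.
by rewrite /step_mean -sumrB; apply: eq_bigr => e _; rewrite mulrBr.
Qed.

Lemma step_meanZ w z (a : R) (h : lattice d.+1 -> R) :
  step_mean w z (fun y => a * h y) = a * step_mean w z h.
Proof.
by rewrite /step_mean mulr_sumr; apply: eq_bigr => e _; rewrite mulrCA.
Qed.

Lemma step_mean_sum w z (m : nat) (h : nat -> lattice d.+1 -> R) :
  step_mean w z (fun y => \sum_(t < m) h t y) = \sum_(t < m) step_mean w z (h t).
Proof.
rewrite /step_mean exchange_big/=; apply: eq_bigr => e _.
by rewrite mulr_sumr.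
Qed.

(** For a functional that is at most 1, the deficit 1 - h after one step is at
    least the part contributed by the direction e. *)
Lemma step_mean_le1B w z e (h : lattice d.+1 -> R) :
  (forall y, h y <= 1) ->
  step_mean w z h <= 1 - trans w z e * (1 - h (z + vec_of e)).
Proof.
move=> h1; rewrite -[X in X - _](step_mean_cst w z).
rewrite lerBrDr -lerBrDl -step_meanB /step_mean (bigD1 e)//= lerDl.
apply: sumr_ge0 => i _; rewrite mulr_ge0 ?trans_ge0// subr_ge0; exact: h1.
Qed.

(** The quenched probability that the walk started at z is in A at all times
    0, ..., t. *)
Fixpoint stay A (t : nat) z w : R :=
  if z \in A then
    if t is t'.+1 then step_mean w z (fun y => stay A t' y w) else 1
  else 0.

Lemma stay_notin A t z w : z \notin A -> stay A t z w = 0.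
Proof. by case: t => [|t] /= /negbTE ->. Qed.

Lemma stay_ge0 A t z w : 0 <= stay A t z w.
Proof.
elim: t z => [|t IH] z /=; case: ifP => // _.
by rewrite -(step_mean_cst w z 0); apply: step_mean_le.
Qed.

Definition shift_env c w : env R d := fun z => w (c + z).

Lemma stay_shift A B c t z w :
  (forall y, (c + y \in B) = (y \in A)) ->
  stay B t (c + z) w = stay A t z (shift_env c w).
Proof.
move=> AB; elim: t z => [|t IH] z /=; rewrite AB; case: ifP => // _.
by apply: eq_bigr => e _; rewrite -addrA IH.
Qed.

(** The quenched mean of s ^ T * g (X_T) over the event T <= N, where T is the
    time at which the walk started at z leaves A. *)
Fixpoint discounted_exit (s : R) A g (N : nat) z w : R :=
  if z \in A then
    if N is N'.+1 then
      s * step_mean w z (fun y => discounted_exit s A g N' y w)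
    else 0
  else g z w.

Section monotonicity.
Context (s : R) (s0 : 0 <= s) (s1 : s <= 1).

Local Notation exit_disc A N z w := (discounted_exit s A (fun _ _ => 1) N z w).

Lemma exit_disc_ge0 A N z w : 0 <= exit_disc A N z w.
Proof.
elim: N z => [|N IH] z /=; case: ifP => // _.
by rewrite mulr_ge0// -(step_mean_cst w z 0); apply: step_mean_le.
Qed.

Lemma exit_disc_le1 A N z w : exit_disc A N z w <= 1.
Proof.
elim: N z => [|N IH] z /=; case: ifP => // _.
rewrite mulr_ile1//.
  rewrite -[leLHS](step_mean_cst w z 0); apply: step_mean_le => e.
  exact: exit_disc_ge0.
by rewrite -[leRHS](step_mean_cst w z 1); apply: step_mean_le.
Qed.

Lemma exit_discS A N z w : exit_disc A N z w <= exit_disc A N.+1 z w.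
Proof.
elim: N z => [|N IH] z; last first.
  rewrite /=; case: ifP => // _; rewrite ler_wpM2l//; apply: step_mean_le => e.
  exact: IH.
rewrite /=; case: ifP => // _; rewrite mulr_ge0//.
rewrite -[leLHS](step_mean_cst w z 0); apply: step_mean_le => e.
exact: (exit_disc_ge0 A 0).
Qed.

Lemma exit_disc_step A N z w : z \in A ->
  exit_disc A N z w <= s * step_mean w z (fun y => exit_disc A N y w).
Proof. by move=> zA; apply: (le_trans (exit_discS _ _ _ _)); rewrite /= zA. Qed.

(** Strong Markov property at the exit time of the smaller set A.  It is only an
    inequality because the right-hand side grants the full horizon N again after
    that time. *)
Lemma exit_disc_strong_markov A B N z w : A `<=` B ->
  exit_disc B N z w <=
  discounted_exit s A (fun y => discounted_exit s B (fun _ _ => 1) N y) N z w.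
Proof.
move=> AB.
have mono N1 g1 g2 y : (forall v, g1 v w <= g2 v w) ->
    discounted_exit s A g1 N1 y w <= discounted_exit s A g2 N1 y w.
  move=> g12; elim: N1 y => [|N1 IH] y /=; case: ifP => // _.
  by rewrite ler_wpM2l//; apply: step_mean_le.
elim: N z => [|N IH] z.
  rewrite /=; case: ifPn => [zB|zB]; case: ifPn => // zA; rewrite ?zB//.
  by move: zB; rewrite inE in zA; rewrite (mem_set (AB _ zA)).
rewrite [leRHS]/=; case: ifPn => // zA.
have zB : z \in B by apply: mem_set; apply: AB; rewrite inE in zA.
rewrite [leLHS]/= zB ler_wpM2l//; apply: step_mean_le => e.
apply: (le_trans (IH _)); apply: mono => v; exact: exit_discS.
Qed.

(** If S is the time spent in C before leaving it, the exit time T of A is at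
    least S, and 1 - s ^ (min S M) is (1 - s) times the sum of s ^ t over
    t < min S M. *)
Lemma exit_disc_trap A C M N z w : C `<=` A ->
  exit_disc A N z w <= 1 - (1 - s) * \sum_(t < M) s ^+ t * stay C t z w.
Proof.
move=> CA; have [zC|zC] := boolP (z \in C); last first.
  rewrite big1 ?mulr0 ?subr0; first exact: exit_disc_le1.
  by move=> t _; rewrite stay_notin// mulr0.
elim: M z zC => [|M IH] z zC.
  by rewrite big_ord0 mulr0 subr0 exit_disc_le1.
have zA : z \in A by apply: mem_set; apply: CA; rewrite inE in zC.
apply: (le_trans (exit_disc_step _ _ zA)).
rewrite big_ord_recl/= zC expr0 mul1r.
have -> : \sum_(t < M) s ^+ bump 0 t * step_mean w z (fun y => stay C t y w) =
    s * step_mean w z (fun y => \sum_(t < M) s ^+ t * stay C t y w).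
  rewrite (step_mean_sum _ _ _ (fun t y => s ^+ t * stay C t y w)) mulr_sumr.
  by apply: eq_bigr => t _; rewrite step_meanZ mulrA -exprS.
set F := fun y => \sum_(t < M) _.
have -> : 1 - (1 - s) * (1 + s * step_mean w z F) =
  s * step_mean w z (fun y => 1 - (1 - s) * F y).
  rewrite (step_meanB w z (fun=> 1)) step_mean_cst step_meanZ; ring.
rewrite ler_wpM2l//; apply: step_mean_le => e.
have [eC|eC] := boolP (z + vec_of e \in C); first exact: IH.
rewrite /F big1 ?mulr0 ?subr0; first exact: exit_disc_le1.
by move=> t _; rewrite stay_notin// mulr0.
Qed.

(** The same delay when C is first reached from y by the steps u and f: the two
    steps only have to happen before the exit from A. *)
Lemma exit_disc_trap2 A C M N y u f w : C `<=` A ->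
  y \in A -> y + vec_of u \in A ->
  exit_disc A N y w <=
  1 - (1 - s) * (trans w y u * trans w (y + vec_of u) f *
        \sum_(t < M) s ^+ t * stay C t (y + vec_of u + vec_of f) w).
Proof.
move=> CA yA yuA; set S := \sum_(t < M) _.
have step1 z e : z \in A -> exit_disc A N z w <=
    1 - trans w z e * (1 - exit_disc A N (z + vec_of e) w).
  move=> zA; apply: (le_trans (exit_disc_step _ _ zA)).
  apply: (@le_trans _ _ (step_mean w z (fun y => exit_disc A N y w))).
    rewrite ler_piMl// -[leLHS](step_mean_cst w z 0); apply: step_mean_le => k.
    exact: exit_disc_ge0.
  apply: (step_mean_le1B _ _ _ (h := fun y => exit_disc A N y w)) => k.
  exact: exit_disc_le1.
have := step1 _ u yA; have := step1 _ f yuA.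
have := @exit_disc_trap A C M N (y + vec_of u + vec_of f) w CA; rewrite -/S.
have := trans_ge0 w y u; have := trans_ge0 w (y + vec_of u) f.
move: (trans w y u) (trans w _ f) (exit_disc A N (_ + vec_of f) w)
  (exit_disc A N (y + vec_of u) w) (exit_disc A N y w) => a b F2 F1 F0.
move=> b0 a0 h2 h1 h0; apply: (le_trans h0); rewrite lerB//.
rewrite [leLHS](_ : _ = a * (b * ((1 - s) * S))); last by ring.
rewrite ler_wpM2l// lerBrDr -lerBrDl (le_trans h1)// lerB// ler_wpM2l//.
by rewrite lerBrDr -lerBrDl.
Qed.

End monotonicity.

(** Markov's inequality for s ^ T: the event T <= N has probability
    1 - stay A N, and s ^ N <= s ^ T on it. *)
Lemma stay_exit_disc s A N z w : 0 <= s -> s <= 1 ->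
  s ^+ N * (1 - stay A N z w) <= discounted_exit s A (fun _ _ => 1) N z w.
Proof.
move=> s0 s1; elim: N z => [|N IH] z /=.
  by rewrite expr0 mul1r; case: ifP; rewrite ?subrr ?subr0.
case: ifP => zA; last by rewrite subr0 mulr1 exprn_ile1.
rewrite exprS -mulrA ler_wpM2l// -{1}(step_mean_cst w z 1) -step_meanB.
by rewrite -step_meanZ; apply: step_mean_le => e; exact: IH.
Qed.

End quenched_functionals.

(** * Integrals that factor through an independent variable *)

Section factorized_integral.
Context d1 d2 (T : measurableType d1) (S : measurableType d2) (R : realType).
Context (mu : {measure set T -> \bar R}).
Context (xi : T -> S) (mxi : measurable_fun setT xi).
Context (h : T -> R) (mh : measurable_fun setT h) (h0 : forall t, 0 <= h t).
Local Open Scope ereal_scope.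

Hypothesis indep : forall B, measurable B ->
  \int[mu]_t (\1_B (xi t) * h t)%:E = mu (xi @^-1` B) * \int[mu]_t (h t)%:E.

Let mh' : measurable_fun setT (EFin \o h : T -> \bar R).
Proof. exact/measurable_EFinP. Qed.

Hypothesis ih_fin : \int[mu]_t (h t)%:E \is a fin_num.

Import HBNNSimple.

Let factorized_simple (g : {nnsfun S >-> R}) :
  \int[mu]_t (g (xi t) * h t)%:E =
  (\int[mu]_t (g (xi t))%:E) * \int[mu]_t (h t)%:E.
Proof.
pose B k := g @^-1` [set k].
have mB k : measurable (B k) by exact: measurable_sfunP.
have mxiB k : measurable (xi @^-1` (B k)).
  by rewrite -[X in measurable X]setTI; exact: mxi.
have m1 k : measurable_fun setT (fun t => \1_(B k) (xi t) : R).
  by apply: (measurableT_comp (measurable_indic _)) => //; exact: mB.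
have gE t : g (xi t) =
    (\sum_(k <- finmap.enum_fset (fset_set (range g))) k * \1_(B k) (xi t))%R.
  by rewrite fimfunE fsbig_finite.
have k0 k t : (0 <= k * \1_(B k) (xi t))%R.
  by have := nnfun_muleindic_ge0 g k (xi t); rewrite -EFinM lee_fin.
have i1 k : \int[mu]_t (k * \1_(B k) (xi t))%:E = k%:E * mu (xi @^-1` B k).
  have [kn|kp] := ltP k 0%R.
    have B0 : B k = set0 by exact: preimage_nnfun0.
    rewrite B0 preimage_set0 measure0 mule0.
    by apply: integral0_eq => t _; rewrite indicE in_set0 mulr0.
  under eq_integral do rewrite EFinM.
  rewrite ge0_integralZl_EFin//; last first.
    exact/measurable_EFinP.
  congr (_ * _); rewrite -[in RHS](setIT (xi @^-1` B k)).
  by rewrite -(integral_indic mu measurableT).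
have i2 k : \int[mu]_t (k * \1_(B k) (xi t) * h t)%:E =
    k%:E * mu (xi @^-1` B k) * \int[mu]_t (h t)%:E.
  have [kn|kp] := ltP k 0%R.
    have B0 : B k = set0 by exact: preimage_nnfun0.
    rewrite B0 preimage_set0 measure0 mule0 mul0e.
    by apply: integral0_eq => t _; rewrite indicE in_set0 mulr0 mul0r.
  under eq_integral do rewrite -mulrA EFinM.
  rewrite ge0_integralZl_EFin//; last 2 first.
  - by move=> t _; rewrite lee_fin mulr_ge0.
  - by apply/measurable_EFinP; apply: measurable_funM.
  by rewrite indep// muleA.
under eq_integral do rewrite gE mulr_suml -sumEFin.
under [in RHS]eq_integral do rewrite gE -sumEFin.
rewrite !ge0_integral_sum//; last 4 first.
- by move=> k; apply/measurable_EFinP/measurable_funM.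
- by move=> k t _; rewrite lee_fin k0.
- by move=> k; apply/measurable_EFinP/measurable_funM => //; exact: measurable_funM.
- by move=> k t _; rewrite lee_fin mulr_ge0.
under eq_bigr do rewrite i2.
under [in RHS]eq_bigr do rewrite i1.
rewrite ge0_sume_distrl// => k _; rewrite -i1.
by apply: integral_ge0 => t _; rewrite lee_fin k0.
Qed.

(** Independence of h from the events defined by xi passes to nonnegative
    functions of xi by simple functions and monotone convergence. *)
Lemma factorized_integral (f : S -> R) : measurable_fun setT f ->
  (forall s, (0 <= f s)%R) ->
  \int[mu]_t (f (xi t) * h t)%:E =
  (\int[mu]_t (f (xi t))%:E) * \int[mu]_t (h t)%:E.
Proof.
move=> mf f0.
have mf' : measurable_fun setT (EFin \o f : S -> \bar R) by exact/measurable_EFinP.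
pose g := nnsfun_approx measurableT mf'.
have gcvg s : (g n s)%:E @[n --> \oo] --> (f s)%:E.
  by apply: (cvg_nnsfun_approx measurableT mf') => // ? _; rewrite /= lee_fin.
have gnd s : {homo (fun n => g n s) : m n / (m <= n)%N >-> (m <= n)%R}.
  by move=> m n mn; exact/lefP/nd_nnsfun_approx.
have mg n : measurable_fun setT (fun t => g n (xi t)).
  exact: (measurableT_comp (f := g n)).
have c1 : \int[mu]_t (g n (xi t))%:E @[n --> \oo] --> \int[mu]_t (f (xi t))%:E.
  rewrite (_ : \int[mu]_t (f (xi t))%:E =
      \int[mu]_t limn (fun n => (g n (xi t))%:E)); last first.
    by apply: eq_integral => t _; exact/esym/cvg_lim.
  apply: cvg_monotone_convergence => //.
  - by move=> n; exact/measurable_EFinP.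
  - by move=> n t _; rewrite lee_fin.
  - by move=> t _ m n mn; rewrite lee_fin gnd.
have c2 : \int[mu]_t (g n (xi t) * h t)%:E @[n --> \oo] -->
    \int[mu]_t (f (xi t) * h t)%:E.
  rewrite (_ : \int[mu]_t (f (xi t) * h t)%:E =
      \int[mu]_t limn (fun n => (g n (xi t) * h t)%:E)); last first.
    apply: eq_integral => t _; apply/esym/cvg_lim => //.
    under eq_fun do rewrite EFinM.
    by rewrite EFinM; apply: cvgeZr => //; exact: gcvg.
  apply: cvg_monotone_convergence => //.
  - by move=> n; apply/measurable_EFinP/measurable_funM.
  - by move=> n t _; rewrite lee_fin mulr_ge0.
  - by move=> t _ m n mn; rewrite lee_fin ler_wpM2r// gnd.
have gfE : (fun n => \int[mu]_t (g n (xi t) * h t)%:E) =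
    (fun n => (\int[mu]_t (g n (xi t))%:E) * \int[mu]_t (h t)%:E).
  by apply/funext => n; exact: factorized_simple.
rewrite gfE in c2.
have c3 : (\int[mu]_t (g n (xi t))%:E) * \int[mu]_t (h t)%:E @[n --> \oo] -->
    (\int[mu]_t (f (xi t))%:E) * \int[mu]_t (h t)%:E by exact: cvgeZr.
exact: cvg_unique c2 c3.
Qed.

End factorized_integral.

(** * Means over an i.i.d. environment *)

Section environment_expectation.
Context (R : realType) (d : nat) (P : probability (env R d) R).
Implicit Types (w : env R d) (x y z c : lattice d.+1) (e f u : direction d.+1).

Lemma measurable_at_site x : measurable_fun setT (fun w => w x : site R d).
Proof.
move=> _ B mB; rewrite setTI; apply: sub_sigma_algebra; by exists x, B.
Qed.

Lemma measurable_coord e :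
  measurable_fun setT (fun p : site R d => (p : simplex R d.+1) e).
Proof.
move=> _ B mB; rewrite setTI; apply: sub_sigma_algebra; by exists e, B.
Qed.

Lemma measurable_trans x e : measurable_fun setT (fun w => trans w x e).
Proof.
exact: (measurableT_comp (measurable_coord e) (measurable_at_site x)).
Qed.

Definition mean (h : env R d -> R) : R := \int[P]_w h w.

Definition bounded_mfun (h : env R d -> R) :=
  measurable_fun setT h /\ exists M, forall w, `|h w| <= M.

Lemma bounded_mfun_integrable h :
  bounded_mfun h -> P.-integrable setT (EFin \o h).
Proof.
move=> [mh [M hM]]; apply: measurable_bounded_integrable => //.
  by apply: (le_lt_trans (probability_le1 P measurableT)); rewrite ltry.
exists M; split; first exact: num_real.
by move=> N MN w _ /=; apply: (le_trans (hM w)); exact: ltW.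
Qed.

Lemma EFin_mean h : bounded_mfun h -> (mean h)%:E = (\int[P]_w (h w)%:E)%E.
Proof.
move=> bh; rewrite /mean /Rintegral fineK//.
exact: integrable_fin_num (bounded_mfun_integrable bh).
Qed.

Section product.
Hypothesis iidP : iid P.

(* The product rule for events is turned into one for functions one site at a
   time: S2 lists the sites that still carry an indicator, S1 those that already
   carry an arbitrary function. *)
Let iid_prod_aux (S1 S2 : seq (lattice d.+1))
    (h : lattice d.+1 -> site R d -> R) : uniq (S1 ++ S2) ->
  (forall x, measurable_fun setT (h x)) -> (forall x p, 0 <= h x p <= 1) ->
  (forall x, x \in S2 -> exists A : set (site R d), h x = \1_A) ->
  (\int[P]_w (\prod_(x <- S1 ++ S2) h x (w x))%:E =
   \prod_(x <- S1 ++ S2) \int[P]_w (h x (w x))%:E)%E.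
Proof.
elim: S1 S2 h => [|x S1 IH] S2 h /= uS mh h01 hS2.
  pose A x := h x @^-1` [set 1].
  have mA x : measurable (A x).
    by rewrite /A -[X in measurable X]setTI; exact: mh.
  have hA x : x \in S2 -> h x = \1_(A x).
    move=> /hS2[B hB]; apply/funext => p; rewrite /A hB !indicE /=.
    case: (boolP (p \in B)) => pB; case: (boolP (p \in _)) => //.
      by rewrite notin_setE /= indicE pB.
    rewrite inE/= indicE (negbTE pB) => /eqP.
    by rewrite eq_sym oner_eq0.
  have mAx x : measurable [set w : env R d | A x (w x)].
    by rewrite -[X in measurable X]setTI; exact: measurable_at_site.
  have -> : (\int[P]_w (\prod_(x <- S2) h x (w x))%:E =
      \int[P]_w (\1_[set w : env R d | forall x, x \in S2 -> A x (w x)] w)%:E)%E.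
    apply: eq_integral => w _; congr EFin; rewrite indicE.
    case: (boolP (w \in _)).
      rewrite inE /= => wA; rewrite big_seq big1// => x xS; exact: wA.
    rewrite notin_setE /= => /existsNP[x] /not_implyP[xS nA].
    by rewrite (big_rem x)//= hA// indicE memNset// mul0r.
  rewrite integral_indic//; last first.
    rewrite (_ : [set w | _] =
        \bigcap_(x in [set` S2]) [set w : env R d | A x (w x)]).
      by apply: fin_bigcap_measurable => //; exact: finite_seq.
    by apply/seteqP; split => [w /= wA x /= /wA|w wA x xS2]//; exact: (wA x).
  rewrite setIT; have /= -> := iidP.2 S2 A uS mA; apply: eq_big_seq => x xS.
  by move=> /=; rewrite hA// -[in LHS](setIT [set w | _]) -integral_indic.
have /andP[xS uS'] := uS.
rewrite !big_cons.
have mP (h' : lattice d.+1 -> site R d -> R) (S : seq (lattice d.+1)) :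
    (forall x, measurable_fun setT (h' x)) ->
    measurable_fun setT (fun w : env R d => \prod_(y <- S) h' y (w y)).
  move=> mh'; apply: measurable_prod => y _.
  exact: (measurableT_comp (mh' y) (measurable_at_site y)).
have P01 (h' : lattice d.+1 -> site R d -> R) (S : seq (lattice d.+1))
    (w : env R d) :
    (forall x p, 0 <= h' x p <= 1) -> 0 <= \prod_(y <- S) h' y (w y) <= 1.
  move=> h'01; elim/big_ind : _ => //; first by rewrite ler01 lexx.
  move=> a b /andP[a0 a1] /andP[b0 b1]; by rewrite mulr_ge0// mulr_ile1.
have intS S : (\int[P]_w (\prod_(y <- S) h y (w y))%:E)%E \is a fin_num.
  rewrite -EFin_mean//; split; first exact: mP.
  exists 1 => w; have /andP[a0 a1] := P01 h S w h01.
  by rewrite ger0_norm.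
under eq_integral do rewrite big_cons.
rewrite (@factorized_integral _ _ _ _ _ P (fun w : env R d => w x : site R d)
    (measurable_at_site x) (fun w => \prod_(y <- S1 ++ S2) h y (w y)))//.
- by rewrite IH// => y yS2; exact: hS2.
- exact: mP.
- by move=> w; have /andP[] := P01 h (S1 ++ S2) w h01.
- move=> B mB.
  pose h' y := if y == x then \1_B else h y.
  have h'E y : y != x -> h' y = h y by rewrite /h' => /negbTE ->.
  have h'x : h' x = \1_B by rewrite /h' eqxx.
  have nx y : y \in S1 ++ S2 -> y != x by apply: contraTneq => ->.
  have pS : perm_eq (S1 ++ x :: S2) (x :: S1 ++ S2).
    by rewrite perm_catC/= perm_cons perm_catC.
  have mh' y : measurable_fun setT (h' y).
    by rewrite /h'; case: ifP => _ //; exact: measurable_indic.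
  have h'01 y p : 0 <= h' y p <= 1.
    rewrite /h'; case: ifP => _ //.
    by rewrite indicE; case: (p \in B); rewrite /= ?lexx ?ler01.
  have h'S2 y : y \in x :: S2 -> exists A : set (site R d), h' y = \1_A.
    rewrite inE => /orP[/eqP->|yS2]; first by exists B.
    by rewrite h'E ?nx// ?mem_cat ?yS2 ?orbT//; exact: hS2.
  have uS'' : uniq (S1 ++ x :: S2) by rewrite (perm_uniq pS).
  have := IH (x :: S2) h' uS'' mh' h'01 h'S2.
  rewrite [in RHS](perm_big _ pS) /= big_cons h'x.
  have eqS T (u : T -> T -> T) i
      (F : (lattice d.+1 -> site R d -> R) -> lattice d.+1 -> T) :
      (forall y, h' y = h y -> F h' y = F h y) ->
      \big[u/i]_(y <- S1 ++ S2) F h' y = \big[u/i]_(y <- S1 ++ S2) F h y.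
    by move=> FE; apply: eq_big_seq => y /nx /h'E; exact: FE.
  rewrite (eqS _ _ _ (fun g y => \int[P]_w (g y (w y))%:E)%E); last by move=> y ->.
  have {}mB : measurable [set w : env R d | B (w x)].
    by rewrite -[X in measurable X]setTI; exact: measurable_at_site.
  rewrite (_ : \int[P]_w (\1_B (w x))%:E =
      P [set w : env R d | B (w x)])%E; last first.
    by rewrite -(setIT [set w : env R d | B (w x)]) -(integral_indic P measurableT).
  rewrite (IH S2 h uS' mh h01 hS2).
  move=> <-; apply: eq_integral => w _.
  rewrite (perm_big _ pS)/= big_cons h'x.
  by rewrite (eqS _ _ _ (fun g y => g y (w y)))// => y ->.
- by move=> s; case/andP: (h01 x s).
Qed.

Lemma mean_prod_sites (S : seq (lattice d.+1))
    (h : lattice d.+1 -> site R d -> R) : uniq S ->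
  (forall x, measurable_fun setT (h x)) -> (forall x p, 0 <= h x p <= 1) ->
  mean (fun w => \prod_(x <- S) h x (w x)) =
  \prod_(x <- S) mean (fun w => h x (w x)).
Proof.
move=> uS mh h01.
have b1 x : bounded_mfun (fun w => h x (w x)).
  split; first exact: (measurableT_comp (mh x) (measurable_at_site x)).
  by exists 1 => w; have /andP[a0 a1] := h01 x (w x); rewrite ger0_norm.
have bS : bounded_mfun (fun w => \prod_(x <- S) h x (w x)).
  split; first by apply: measurable_prod => x _; exact: (b1 x).1.
  exists 1 => w; rewrite normr_prod; apply: prodr_ile1 => x _.
  by have /andP[a0 a1] := h01 x (w x); rewrite ger0_norm ?a0.
apply: EFin_inj; rewrite EFin_mean// -prodEFin.
under [RHS]eq_bigr do rewrite EFin_mean//.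
have := @iid_prod_aux S [::] h; rewrite cats0 => ->//.
Qed.

Lemma mean_at_site (g : site R d -> R) x : measurable_fun setT g ->
  (forall p, 0 <= g p <= 1) ->
  mean (fun w => g (w x)) = mean (fun w => g (w 0)).
Proof.
move=> mg g01; rewrite /mean /Rintegral; congr fine.
have pE y : (\int[P]_w (g (w y))%:E =
    \int[pushforward P (fun w : env R d => w y : site R d)]_p (g p)%:E)%E.
  rewrite ge0_integral_pushforward//.
  - exact: measurable_at_site.
  - exact/measurable_EFinP.
  - by move=> p _; rewrite lee_fin; case/andP: (g01 p).
rewrite !pE; apply: eq_measure_integral; [exact: measurable_at_site..|].
by move=> mx m0 A mA AT; exact: iidP.1.
Qed.


Definition monomial (s : seq (lattice d.+1 * direction d.+1)) w : R :=
  \prod_(a <- s) trans w a.1 a.2.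

Let site_monomial (s : seq (lattice d.+1 * direction d.+1)) x
    (p : site R d) : R :=
  \prod_(a <- s | a.1 == x) (p : simplex R d.+1) a.2.

Let measurable_site_monomial s x : measurable_fun setT (site_monomial s x).
Proof.
rewrite /site_monomial; under eq_fun do rewrite -big_filter.
by apply: measurable_prod => a _; exact: measurable_coord.
Qed.

Let site_monomial01 s x p : 0 <= site_monomial s x p <= 1.
Proof.
rewrite prodr_ge0/=; last by move=> a _; exact: simplex_ge0.
apply: prodr_ile1 => a _; rewrite simplex_ge0/=.
exact: (trans_le1 (fun=> p : site R d) 0).
Qed.

Let monomialE s (S : seq (lattice d.+1)) w : uniq S ->
  {subset map fst s <= S} ->
  monomial s w = \prod_(x <- S) site_monomial s x (w x).
Proof.
move=> uS sS; rewrite /site_monomial (exchange_big_dep predT)//=.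
rewrite /monomial; apply: eq_big_seq => a as_.
rewrite big_mkcond/= (bigD1_seq a.1)//=; last by apply/sS/map_f.
by rewrite eqxx big1 ?mulr1// => x; rewrite eq_sym => /negbTE ->.
Qed.

Let mean_monomialE s (S : seq (lattice d.+1)) : uniq S ->
  {subset map fst s <= S} ->
  mean (monomial s) = \prod_(x <- S) mean (fun w => site_monomial s x (w 0)).
Proof.
move=> uS sS; rewrite (_ : monomial s =
    fun w => \prod_(x <- S) site_monomial s x (w x)); last first.
  by apply/funext => w; exact: monomialE.
rewrite mean_prod_sites//; apply: eq_bigr => x _; exact: mean_at_site.
Qed.

Lemma mean_monomial_shift s c :
  mean (monomial [seq (c + a.1, a.2) | a <- s]) = mean (monomial s).
Proof.
pose S := undup (map fst s).
have uS : uniq S by exact: undup_uniq.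
rewrite (@mean_monomialE s _ uS); last by move=> x xs; rewrite mem_undup.
rewrite (@mean_monomialE _ (map (fun x => c + x) S)).
- rewrite big_map; apply: eq_bigr => x _; congr mean; apply/funext => w.
  rewrite /site_monomial big_map/=; apply: eq_bigl => a.
  by rewrite (inj_eq (addrI c)).
- by rewrite map_inj_uniq//; exact: addrI.
- move=> x /mapP[a /mapP[a' a's ->] ->] /=; apply: map_f.
  by rewrite mem_undup; exact: map_f.
Qed.

Lemma mean_monomial_cat s1 s2 :
  (forall a1 a2, a1 \in s1 -> a2 \in s2 -> a1.1 != a2.1) ->
  mean (monomial (s1 ++ s2)) = mean (monomial s1) * mean (monomial s2).
Proof.
move=> dis; pose S1 := undup (map fst s1); pose S2 := undup (map fst s2).
have S12 x : x \in S1 -> x \in S2 -> False.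
  rewrite !mem_undup => /mapP[a as1 ->] /mapP[b bs2 ab].
  by have := dis _ _ as1 bs2; rewrite ab eqxx.
rewrite (@mean_monomialE _ (S1 ++ S2)); last 2 first.
- rewrite cat_uniq !undup_uniq/= andbT; apply/hasPn => x x2.
  by apply/negP => /S12; exact.
- by move=> x; rewrite map_cat !mem_cat !mem_undup.
rewrite big_cat/=; congr (_ * _).
- rewrite (@mean_monomialE s1 S1) ?undup_uniq//;
    last by move=> x xs; rewrite mem_undup.
  apply: eq_big_seq => x x1; congr mean; apply/funext => w.
  rewrite /site_monomial big_cat/= [X in _ * X]big_seq_cond [X in _ * X]big1 ?mulr1//.
  move=> a /andP[as2 /eqP ax]; exfalso; apply: (S12 x) => //.
  by rewrite mem_undup -ax map_f.
- rewrite (@mean_monomialE s2 S2) ?undup_uniq//;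
    last by move=> x xs; rewrite mem_undup.
  apply: eq_big_seq => x x1; congr mean; apply/funext => w.
  rewrite /site_monomial big_cat/= [X in X * _]big_seq_cond [X in X * _]big1 ?mul1r//.
  move=> a /andP[as2 /eqP ax]; exfalso; apply: (S12 x) => //.
  by rewrite mem_undup -ax map_f.
Qed.

End product.
End environment_expectation.

(** * Polynomials in the entries of the environment *)

Section environment_polynomials.
Context (R : realType) (d : nat).
Implicit Types (w : env R d) (x y z : lattice d.+1) (e f u : direction d.+1).
Implicit Types (D : set (lattice d.+1)) (h k : env R d -> R).

(** Membership in the algebra generated by the transition probabilities at the
    sites of D.  It stands in for measurability with respect to these sites, and
    also brings boundedness. *)
Definition env_poly D h : Prop :=
  exists cs : seq (R * seq (lattice d.+1 * direction d.+1)),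
    (forall c a, c \in cs -> a \in c.2 -> D a.1) /\
    h = fun w => \sum_(c <- cs) c.1 * monomial c.2 w.

Lemma env_poly_sub D D' h : D `<=` D' -> env_poly D h -> env_poly D' h.
Proof. by move=> DD' [cs [csD ->]]; exists cs; split=> // c a /csD H /H /DD'. Qed.

Lemma env_poly_cst D (r : R) : env_poly D (fun=> r).
Proof.
exists [:: (r, [::])]; split => [c a|]; first by rewrite inE => /eqP ->.
by apply/funext => w; rewrite big_seq1 /monomial big_nil mulr1.
Qed.

Lemma env_poly_trans D x e : D x -> env_poly D (fun w => trans w x e).
Proof.
move=> Dx; exists [:: (1, [:: (x, e)])]; split => [c a|].
  by rewrite inE => /eqP -> /=; rewrite inE => /eqP ->.
by apply/funext => w; rewrite big_seq1 /monomial big_seq1 mul1r.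
Qed.

Lemma env_polyD D h k : env_poly D h -> env_poly D k ->
  env_poly D (fun w => h w + k w).
Proof.
move=> [hs [hD ->]] [ks [kD ->]]; exists (hs ++ ks); split.
  by move=> c a; rewrite mem_cat => /orP[/hD|/kD]; exact.
by apply/funext => w; rewrite big_cat.
Qed.

Lemma env_polyM D h k : env_poly D h -> env_poly D k ->
  env_poly D (fun w => h w * k w).
Proof.
move=> [hs [hD ->]] [ks [kD ->]].
exists [seq (a.1 * b.1, a.2 ++ b.2) | a <- hs, b <- ks]; split.
  move=> c a /allpairsP[[p q] /= [ph qk ->]] /=; rewrite mem_cat.
  by move=> /orP[]; [exact: hD ph|exact: kD qk].
apply/funext => w; rewrite big_allpairs_dep mulr_suml; apply: eq_bigr => a _.
rewrite mulr_sumr; apply: eq_bigr => b _ /=.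
by rewrite /monomial big_cat/= mulrACA.
Qed.

Lemma env_poly_sum D (I : Type) (s : seq I) (h : I -> env R d -> R) :
  (forall i, env_poly D (h i)) -> env_poly D (fun w => \sum_(i <- s) h i w).
Proof.
move=> Dh; elim: s => [|i s IH].
  by under eq_fun do rewrite big_nil; exact: env_poly_cst.
by under eq_fun do rewrite big_cons; exact: env_polyD.
Qed.

Lemma env_polyB D h k : env_poly D h -> env_poly D k ->
  env_poly D (fun w => h w - k w).
Proof.
move=> Dh Dk; apply: env_polyD => //.
under eq_fun do rewrite -mulN1r; apply: env_polyM => //; exact: env_poly_cst.
Qed.

Lemma env_poly_step_mean D x (h : lattice d.+1 -> env R d -> R) : D x ->
  (forall e, env_poly D (h (x + vec_of e))) ->
  env_poly D (fun w => step_mean w x (fun y => h y w)).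
Proof.
move=> Dx Dh; rewrite /step_mean.
apply: (@env_poly_sum D _ _ (fun e w => trans w x e * h (x + vec_of e) w)) => e.
by apply: env_polyM => //; exact: env_poly_trans.
Qed.

Lemma env_poly_stay D A t z : A `<=` D -> env_poly D (stay A t z).
Proof.
move=> AD; elim: t z => [|t IH] z.
  by rewrite /stay; case: ifP => _; exact: env_poly_cst.
have [zA|zA] := boolP (z \in A); last first.
  rewrite (_ : stay A t.+1 z = fun=> 0); first exact: env_poly_cst.
  by apply/funext => w; exact: stay_notin.
rewrite /= zA; apply: env_poly_step_mean => //.
by apply: AD; rewrite inE in zA.
Qed.

Lemma env_poly_discounted_exit s A (g : lattice d.+1 -> env R d -> R) N z :
  (forall y, env_poly setT (g y)) -> env_poly setT (discounted_exit s A g N z).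
Proof.
move=> Dg; elim: N z => [|N IH] z /=.
  by case: (z \in A) => //; exact: env_poly_cst.
case: (z \in A) => //; apply: env_polyM; first exact: env_poly_cst.
exact: env_poly_step_mean.
Qed.

Lemma monomial_ge0 s w : 0 <= monomial s w.
Proof. by apply: prodr_ge0 => a _; exact: trans_ge0. Qed.

Lemma monomial_le1 s w : monomial s w <= 1.
Proof. by apply: prodr_ile1 => a _; rewrite trans_ge0 trans_le1. Qed.

Lemma bounded_mfun_monomial s : bounded_mfun (@monomial R d s).
Proof.
split; first by apply: measurable_prod => a _; exact: measurable_trans.
by exists 1 => w; rewrite ger0_norm ?monomial_le1// monomial_ge0.
Qed.

Lemma bounded_mfunD h k : bounded_mfun h -> bounded_mfun k ->
  bounded_mfun (fun w => h w + k w).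
Proof.
move=> [mh [M hM]] [mk [N kN]]; split; first exact: measurable_funD.
by exists (M + N) => w; rewrite (le_trans (ler_normD _ _))// lerD.
Qed.

Lemma bounded_mfunZ r h : bounded_mfun h -> bounded_mfun (fun w => r * h w).
Proof.
move=> [mh [M hM]]; split; first by apply: measurable_funM.
by exists (`|r| * M) => w; rewrite normrM ler_wpM2l.
Qed.

Lemma env_poly_bounded_mfun D h : env_poly D h -> bounded_mfun h.
Proof.
move=> [cs [_ ->]]; elim: cs => [|c cs IH].
  under eq_fun do rewrite big_nil; split; first exact: measurable_cst.
  by exists 0 => w; rewrite normr0.
under eq_fun do rewrite big_cons; apply: bounded_mfunD => //.
exact/bounded_mfunZ/bounded_mfun_monomial.
Qed.

Section mean.
Context (P : probability (env R d) R).

Lemma mean_cst r : mean P (fun=> r) = r.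
Proof.
rewrite /mean Rintegral_cst// -[RHS]mulr1; congr (_ * _).
exact: (congr1 fine (probability_setT P)).
Qed.

Lemma meanD h k : bounded_mfun h -> bounded_mfun k ->
  mean P (fun w => h w + k w) = mean P h + mean P k.
Proof.
by move=> bh bk; rewrite /mean RintegralD//; exact: bounded_mfun_integrable.
Qed.

Lemma meanZ r h : bounded_mfun h -> mean P (fun w => r * h w) = r * mean P h.
Proof.
by move=> bh; rewrite /mean RintegralZl//; exact: bounded_mfun_integrable.
Qed.

Lemma mean_le h k : bounded_mfun h -> bounded_mfun k -> (forall w, h w <= k w) ->
  mean P h <= mean P k.
Proof.
by move=> bh bk hk; apply: le_Rintegral => //; exact: bounded_mfun_integrable.
Qed.

Lemma mean_sum (I : Type) (s : seq I) (h : I -> env R d -> R) :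
  (forall i, bounded_mfun (h i)) ->
  mean P (fun w => \sum_(i <- s) h i w) = \sum_(i <- s) mean P (h i) /\
  bounded_mfun (fun w => \sum_(i <- s) h i w).
Proof.
move=> bh; elim: s => [|i s [IH1 IH2]].
  under eq_fun do rewrite big_nil; rewrite mean_cst big_nil; split => //.
  exact: env_poly_bounded_mfun (env_poly_cst setT _).
under eq_fun do rewrite big_cons; rewrite meanD// big_cons IH1; split => //.
exact: bounded_mfunD.
Qed.

Hypothesis iidP : iid P.

(** Stationarity of the environment. *)
Lemma mean_env_poly_shift D h (c : lattice d.+1) : env_poly D h ->
  mean P (fun w => h (shift_env c w)) = mean P h.
Proof.
move=> [cs [_ ->]].
have bs (f : seq (lattice d.+1 * direction d.+1) ->
             seq (lattice d.+1 * direction d.+1))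
    (p : R * seq (lattice d.+1 * direction d.+1)) :
    bounded_mfun (fun w : env R d => p.1 * monomial (f p.2) w).
  exact/bounded_mfunZ/bounded_mfun_monomial.
rewrite (mean_sum _ (bs id)).1.
pose sh s : seq (lattice d.+1 * direction d.+1) := [seq (c + a.1, a.2) | a <- s].
rewrite (_ : (fun w => _) = fun w => \sum_(p <- cs) p.1 * monomial (sh p.2) w).
  rewrite (mean_sum _ (bs sh)).1; apply: eq_bigr => p _.
  rewrite !meanZ; try exact: bounded_mfun_monomial.
  by rewrite mean_monomial_shift.
apply/funext => w; apply: eq_bigr => p _; congr (_ * _).
by rewrite /monomial big_map.
Qed.

(** Independence of disjoint parts of the environment. *)
Lemma mean_env_polyM D D' h k : env_poly D h -> env_poly D' k ->
  D `&` D' = set0 -> mean P (fun w => h w * k w) = mean P h * mean P k.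
Proof.
move=> [hs [hD ->]] [ks [kD ->]] DD'.
have bs (p : R * seq (lattice d.+1 * direction d.+1)) :
    bounded_mfun (fun w : env R d => p.1 * monomial p.2 w).
  exact/bounded_mfunZ/bounded_mfun_monomial.
rewrite !(mean_sum _ bs).1.
pose prod := [seq (p.1 * q.1, p.2 ++ q.2) | p <- hs, q <- ks].
rewrite (_ : (fun w => _) = fun w => \sum_(p <- prod) p.1 * monomial p.2 w).
  rewrite (mean_sum _ bs).1 big_allpairs_dep mulr_suml; apply: eq_big_seq => p ph.
  rewrite mulr_sumr; apply: eq_big_seq => q qk /=.
  rewrite !meanZ; try exact: bounded_mfun_monomial.
  rewrite mean_monomial_cat// 1?mulrACA// => a b ap bq; apply/negP => /eqP ab.
  have : (D `&` D') a.1 by split; [exact: hD ph ap|rewrite ab; exact: kD qk bq].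
  by rewrite DD'.
apply/funext => w; rewrite big_allpairs_dep mulr_suml; apply: eq_bigr => p _.
rewrite mulr_sumr; apply: eq_bigr => q _ /=.
by rewrite /monomial big_cat/= mulrACA.
Qed.

End mean.
End environment_polynomials.

(** * Trajectories *)

Section trajectories.
Context (R : realType) (d : nat).
Implicit Types (w : env R d) (x y z : lattice d.+1) (e : direction d.+1).
Implicit Types (A : set (lattice d.+1)).

Lemma vec_of_inj : injective (@vec_of d.+1).
Proof.
move=> [i a] [j b]; rewrite /vec_of /= => /rowP ab.
have := ab i; rewrite !mxE !eqxx/= mulr1.
have [<-|ij] := eqVneq i j; rewrite /= ?mulr1 ?mulr0; last first.
  by move/eqP; rewrite signr_eq0.
by move=> /signr_inj ->.
Qed.

Definition staying A (t : nat) : set (traj d.+1) :=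
  [set X | forall j, (j <= t)%N -> X j \in A].

Definition path_prefix (n : nat) (s : nat -> lattice d.+1) : set (traj d.+1) :=
  [set X | forall i, (i <= n)%N -> X i = s i].

Lemma measurable_position n A : measurable [set X : traj d.+1 | X n \in A].
Proof.
have m1 y : measurable [set X : traj d.+1 | X n = y].
  by apply: sub_sigma_algebra; exists n, y.
rewrite (_ : [set _ | _] =
    \bigcup_y (if y \in A then [set X : traj d.+1 | X n = y] else set0)).
  apply: countable_bigcupT_measurable; first exact: countableP.
  by move=> y; case: ifP.
apply/seteqP; split => X /=; first by move=> XA; exists (X n) => //; rewrite XA.
by move=> [y _]; case: ifP => //= yA ->.
Qed.

Lemma measurable_forall_le t (F : nat -> set (traj d.+1)) :
  (forall i, measurable (F i)) ->
  measurable [set X : traj d.+1 | forall j, (j <= t)%N -> F j X].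
Proof.
move=> mF; rewrite (_ : [set _ | _] = \bigcap_(j in [set j | (j <= t)%N]) F j).
  exact: bigcap_measurableType.
by apply/seteqP; split => X /= H j; exact: H.
Qed.

Lemma measurable_staying A t : measurable (staying A t).
Proof.
apply: (@measurable_forall_le _ (fun j => [set X : traj d.+1 | X j \in A])).
by move=> j; exact: measurable_position.
Qed.

Lemma measurable_path_prefix n s : measurable (path_prefix n s).
Proof.
apply: (@measurable_forall_le _ (fun j => [set X : traj d.+1 | X j = s j])).
by move=> j; apply: sub_sigma_algebra; exists j, (s j).
Qed.

Let measure_bigsetU_seq (mu : {measure set (traj d.+1) -> \bar R}) (I : eqType)
    (r : seq I) (F : I -> set (traj d.+1)) : uniq r ->
  (forall i, measurable (F i)) -> (forall i j, i != j -> F i `&` F j = set0) ->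
  mu (\big[setU/set0]_(i <- r) F i) = (\sum_(i <- r) mu (F i))%E.
Proof.
move=> + mF dF; elim: r => [|i r IH]; first by rewrite !big_nil measure0.
rewrite /= => /andP[ir ur]; rewrite !big_cons measureU//.
- by congr (_ + _)%E; exact: IH.
- exact: bigsetU_measurable.
- rewrite big_distrr/= big_seq big1// => j jr; apply: dF.
  by apply: contraNneq ir => ->.
Qed.

Section one_law.
Context (w : env R d) (x0 : lattice d.+1).
Context (mu : {measure set (traj d.+1) -> \bar R}) (mu1 : mu setT = 1%E).
Hypothesis markov_mu : markov_law w x0 mu.

Let extend (n : nat) (s : nat -> lattice d.+1) e : nat -> lattice d.+1 :=
  fun i => if (i <= n)%N then s i else s n + vec_of e.

Let path_prefixS n s e : path_prefix n.+1 (extend n s e) =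
  [set X | (forall i, (i <= n)%N -> X i = s i) /\ X n.+1 = s n + vec_of e].
Proof.
apply/seteqP; split => X /= H.
  split; last by rewrite H// /extend ltnn.
  by move=> i ile; rewrite H ?(leq_trans ile)// /extend ile.
move=> i; rewrite leq_eqVlt => /orP[/eqP->|]; first by rewrite /extend ltnn H.2.
by rewrite ltnS => ile; rewrite /extend ile H.1.
Qed.

(** The Markov property for the event of staying in A, by induction on the
    horizon: almost every trajectory with prefix s continues with one of the
    2 d unit steps, since their transition probabilities add up to 1. *)
Lemma prefix_staying A t n s :
  mu (path_prefix n s `&` [set X | forall j, (j <= t)%N -> X (n + j)%N \in A]) =
  (mu (path_prefix n s) * (stay A t (s n) w)%:E)%E.
Proof.
have mE t' n' : measurable
    [set X : traj d.+1 | forall j, (j <= t')%N -> X (n' + j)%N \in A].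
  apply: (@measurable_forall_le _
    (fun j => [set X : traj d.+1 | X (n' + j)%N \in A])) => j.
  exact: measurable_position.
elim: t n s => [|t IH] n s.
  have [zA|zA] := boolP (s n \in A); rewrite /= ?zA ?(negbTE zA).
    rewrite mule1; congr (mu _); apply/seteqP; split => X /=; first by case.
    by move=> H; split => // j; rewrite leqn0 => /eqP ->; rewrite addn0 H.
  rewrite mule0 -(measure0 mu); congr (mu _); apply/seteqP; split => X //=.
  by move=> [H /(_ 0%N isT)]; rewrite addn0 H// (negbTE zA).
have [zA|zA] := boolP (s n \in A); last first.
  rewrite stay_notin// mule0 -(measure0 mu); congr (mu _).
  apply/seteqP; split => X //=.
  by move=> [H /(_ 0%N isT)]; rewrite addn0 H// (negbTE zA).
rewrite /= zA; set E := [set X | _].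
pose C e := path_prefix n.+1 (extend n s e).
have mC e : measurable (C e) by exact: measurable_path_prefix.
have CE e : mu (C e) = ((trans w (s n) e)%:E * mu (path_prefix n s))%E.
  rewrite /C path_prefixS; exact: markov_mu.2.
have dC e f : e != f -> C e `&` C f = set0.
  move=> ef; apply/seteqP; split => X //=; rewrite /C !path_prefixS => -[[_ Xe] [_]].
  by rewrite Xe => /addrI /vec_of_inj /eqP; rewrite (negbTE ef).
pose U := \big[setU/set0]_e C e.
have mU : measurable U by exact: bigsetU_measurable.
have muU : mu U = mu (path_prefix n s).
  rewrite /U measure_bigsetU_seq ?index_enum_uniq//.
  under eq_bigr do rewrite CE.
  rewrite -ge0_sume_distrl; last by move=> e _; rewrite lee_fin trans_ge0.
  by rewrite sumEFin trans_sum1 mul1e.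
have UE : U = \bigcup_(e in [set` index_enum (direction d.+1)]) C e.
  by rewrite bigcup_seq.
have UP : U `<=` path_prefix n s.
  rewrite UE => X [e _]; rewrite /C path_prefixS => -[H _]; exact: H.
set G := path_prefix n s `&` E.
have mG : measurable G.
  by apply: measurableI; [exact: measurable_path_prefix|exact: mE].
have mP : measurable (path_prefix n s) by exact: measurable_path_prefix.
have finP : mu (path_prefix n s) \is a fin_num.
  rewrite ge0_fin_numE// (@le_lt_trans _ _ 1%E) ?ltry// -mu1.
  by apply: le_measure => //; rewrite inE.
(* The trajectories that leave the prefix by anything but a unit step. *)
have null : mu (G `\` U) = 0%E.
  have PU0 : mu (path_prefix n s `\` U) = 0%E.
    have -> : mu (path_prefix n s `\` U) = (mu (path_prefix n s) - mu U)%E.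
      by rewrite -[in RHS](setIidr UP); apply: measureD => //; rewrite ltey_eq finP.
    by rewrite muU subee.
  apply/eqP; rewrite eq_le measure_ge0 andbT -PU0.
  apply: le_measure; rewrite ?inE; [exact: measurableD..|].
  by apply: setSD => X [].
have -> : mu G = mu (G `&` U).
  by rewrite [LHS](measureDI mu mG mU) [X in (X + _)%E]null add0e.
rewrite UE bigcup_seq setIC big_distrl/=.
pose E' : set (traj d.+1) := [set X | forall j, (j <= t)%N -> X (n.+1 + j)%N \in A].
have CG e : C e `&` G = C e `&` E'.
  rewrite /C path_prefixS; apply/seteqP; split => X [[Xs Xe]] H; split => //.
    by move=> j jt; rewrite addSnnS; exact: H.2.
  split => // -[_|j jt]; first by rewrite addn0 Xs.
  by rewrite -addSnnS; exact: H.
rewrite measure_bigsetU_seq ?index_enum_uniq//; last 2 first.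
- by move=> e; exact: measurableI.
- by move=> e f /dC ef; rewrite setIACA ef set0I.
rewrite /step_mean -sumEFin ge0_sume_distrr; last first.
  by move=> e _; rewrite lee_fin mulr_ge0// ?trans_ge0// stay_ge0.
apply: eq_bigr => e _; rewrite CG.
have := IH n.+1 (extend n s e); rewrite -/(C e) -/E' => ->.
by rewrite CE /extend ltnn EFinM (muleC (trans _ _ _)%:E (mu _)) -muleA.
Qed.

Lemma staying_law A t : mu (staying A t) = (stay A t x0 w)%:E.
Proof.
have P1 : mu (path_prefix 0 (fun=> x0)) = 1%E.
  rewrite -[RHS]markov_mu.1; congr (mu _); apply/seteqP; split => X /=.
    by move=> /(_ 0%N); exact.
  by move=> X0 i; rewrite leqn0 => /eqP ->.
have := prefix_staying A t 0 (fun=> x0); rewrite P1 mul1e => <-.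
have mP := measurable_path_prefix 0 (fun=> x0).
rewrite [LHS](measureDI mu (measurable_staying A t) mP).
rewrite [X in (X + _)%E](_ : _ = 0%E) ?add0e; first by rewrite setIC.
apply/eqP; rewrite eq_le measure_ge0 andbT.
apply: (@le_trans _ _ (mu (~` path_prefix 0 (fun=> x0)))).
  apply: le_measure; rewrite ?inE; [|exact: measurableC|by move=> X []].
  by apply: measurableD => //; exact: measurable_staying.
have -> : mu (~` path_prefix 0 (fun=> x0)) =
    (mu setT - mu (path_prefix 0 (fun=> x0)))%E.
  rewrite -setTD -[X in (_ - mu X)%E]setTI; apply: measureD => //.
  by have := ltry (1 : R); rewrite -mu1.
by rewrite mu1 P1 subee.
Qed.

End one_law.
End trajectories.

Section annealed_law.
Context (R : realType) (d : nat) (P : probability (env R d) R).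
Context (Q : lattice d.+1 -> R.-pker (env R d) ~> (traj d.+1)).
Hypothesis QP : quenched_law Q.
Implicit Types (x : lattice d.+1) (A : set (lattice d.+1)).

Lemma annealed_staying A t x :
  annealed P (Q x) (staying A t) = (mean P (stay A t x))%:E.
Proof.
rewrite EFin_mean; last first.
  by apply: env_poly_bounded_mfun; exact: (@env_poly_stay _ _ A A t x).
apply: eq_integral => w _.
by apply: staying_law; [exact: prob_kernel|exact: QP].
Qed.

(** The time of exit is the number of times t such that the walk has not left A
    up to time t. *)
Lemma exit_timeE A (X : traj d.+1) :
  exit_time R A X = (\sum_(0 <= t <oo) (\1_(staying A t) X)%:E)%E.
Proof.
have ind t : (forall j, (j <= t)%N -> A (X j)) -> \1_(staying A t) X = 1 :> R.
  by move=> H; rewrite indicE mem_set// => j jt; apply/mem_set/H.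
have [[n0 nA]|noexit] := pselect (exists n, ~ A (X n)); last first.
  have allA n : A (X n) by apply: contrapT => nA; apply: noexit; exists n.
  rewrite /exit_time (_ : [set n | ~ A (X n)] = set0).
    rewrite image_set0 ereal_inf0; apply/esym/eq_infty => r.
    have [N rN] : exists N : nat, r <= N%:R.
      by exists (Num.truncn `|r|).+1;
        rewrite (le_trans (ler_norm r))// ltW// truncnS_gt.
    apply: (@le_trans _ _ (N%:R%:E)%E); first by rewrite lee_fin.
    apply: le_trans (nneseries_lim_ge N _); last by move=> k _ _; rewrite lee_fin.
    rewrite (eq_bigr (fun=> 1%E)); last by move=> t _; rewrite ind.
    by rewrite sumEFin sumr_const_nat subn0.
  by apply/seteqP; split => n //= /(_ (allA n)).
have exn : exists n, `[< ~ A (X n) >] by exists n0; exact/asboolP.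
case: (ex_minnP exn) => n /asboolP nAn nmin.
have before j : (j < n)%N -> A (X j).
  move=> jn; apply: contrapT => nAj.
  by have := nmin j (asboolT nAj); rewrite leqNgt jn.
transitivity (n%:R%:E : \bar R).
  apply/eqP; rewrite eq_le; apply/andP; split.
    by apply: ereal_inf_lbound; exists n.
  apply: le_ereal_inf_tmp => _ [m nAm <-]; rewrite lee_fin ler_nat.
  by apply: nmin; exact/asboolP.
apply/esym/cvg_lim => //; apply: cvg_near_cst; exists n => // N /= nN.
rewrite (big_cat_nat _ nN)//= [X in (_ + X)%E]big1_seq ?adde0.
  rewrite (eq_big_nat _ _ (F2 := fun=> 1%E)).
    by rewrite sumEFin sumr_const_nat subn0.
  by move=> t /andP[_ tn]; rewrite ind// => j jt; apply: before; exact: leq_ltn_trans tn.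
move=> t /andP[_]; rewrite mem_index_iota => /andP[nt _].
by rewrite indicE memNset//= => /(_ n nt); rewrite inE.
Qed.

Lemma integral_exit_time A x :
  (\int[annealed P (Q x)]_X exit_time R A X =
   \sum_(0 <= t <oo) (mean P (stay A t x))%:E)%E.
Proof.
under eq_integral do rewrite exit_timeE.
rewrite integral_nneseries//; last first.
  move=> t; apply/measurable_EFinP; apply: measurable_indic.
  exact: measurable_staying.
apply: eq_eseriesr => t _; rewrite integral_indic ?setIT//.
  exact: annealed_staying.
exact: measurable_staying.
Qed.

End annealed_law.

(** * Levels and hypercubes *)

Section levels.
Context (d : nat).
Implicit Types (x y z : lattice d.+1) (e f u : direction d.+1).

Definition level u z : int := (-1) ^+ u.2 * z 0 u.1.

Definition below u (a : int) : set (lattice d.+1) := [set z | level u z < a].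

Lemma mem_below u a z : (z \in below u a) = (level u z < a).
Proof. by apply/idP/idP; rewrite inE. Qed.

Lemma levelD u y z : level u (y + z) = level u y + level u z.
Proof. by rewrite /level mxE mulrDr. Qed.

Lemma levelN u z : level u (- z) = - level u z.
Proof. by rewrite /level mxE mulrN. Qed.

Lemma level_vec u f : level u (vec_of f) =
  if u.1 == f.1 then (if u.2 == f.2 then 1 else -1) else 0.
Proof.
rewrite /level /vec_of !mxE eqxx /=; case: eqP => _; last by rewrite !mulr0.
by case: u.2; case: f.2; rewrite /= ?expr0 ?expr1; lia.
Qed.

Lemma level_vec_le1 u f : level u (vec_of f) <= 1.
Proof. by rewrite level_vec; case: eqP => _ //; case: eqP. Qed.

Lemma level_self u : level u (vec_of u) = 1.
Proof. by rewrite level_vec !eqxx. Qed.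

End levels.

Section cube.
Context (d : nat) (H : set (lattice d.+1)) (sg : 'I_d.+1 -> bool).
Hypothesis cubeH : forall z, H z -> forall k,
  z 0 k = 0 \/ z 0 k = (-1) ^+ (sg k).
Implicit Types (x y z : lattice d.+1) (e f u : direction d.+1).

Lemma cube_level_diff u x z : H x -> H z -> `|level u (z - x)| <= 1.
Proof.
move=> Hx Hz; rewrite /level !mxE.
have := cubeH Hx u.1; have := cubeH Hz u.1.
case: (sg _); case: u.2; rewrite /= ?expr0 ?expr1; lia.
Qed.

(** Every point x of the cube has a neighbour outside it along any axis k, namely
    on the side of x away from the cube; the whole hyperplane through this
    neighbour avoids the cube, so that it can be reached without touching the cube. *)
Lemma cube_entrance x (k : 'I_d.+1) : H x -> exists f,
  f.1 = k /\ forall z, z 0 k = (x - vec_of f) 0 k -> ~ H z.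
Proof.
move=> Hx; exists (k, if x 0 k == 0 then sg k else ~~ sg k); split => // z.
rewrite /vec_of !mxE !eqxx /= => zE Hz.
have := cubeH Hx k; have := cubeH Hz k; rewrite zE.
have [->|x0] := eqVneq (x 0 k) 0.
  by case: (sg k); rewrite /= ?expr0 ?expr1; lia.
by case: (sg k); rewrite /= ?expr0 ?expr1; lia.
Qed.

End cube.

(** Orthonormality makes the axes of the basis vectors distinct, hence all axes
    occur once, and sg records the sign with which they do. *)
Lemma hypercube_corners (R : realType) (d : nat) (l : 'rV[R]_d.+1)
    (b : 'I_d.+1 -> direction d.+1) : adapted_basis l b ->
  exists sg : 'I_d.+1 -> bool, forall z, hypercube b z -> forall k,
    z 0 k = 0 \/ z 0 k = (-1) ^+ (sg k).
Proof.
move=> [orth _ _].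
have axis_inj : injective (fun i => (b i).1).
  move=> i j /= bij; apply/eqP; apply: contraT => ij.
  have := orth i j; rewrite (negbTE ij) /dot (bigD1 (b i).1)//= big1.
    rewrite /vec_of !mxE !eqxx bij eqxx /= addr0 !mulr1.
    by case: (b i).2; case: (b j).2; rewrite /= ?expr0 ?expr1; lia.
  move=> k ki; rewrite /vec_of !mxE eqxx/= (negbTE ki).
  by rewrite mulr0 mul0r.
pose inv := invF axis_inj.
have invK k : (b (inv k)).1 = k by exact: (f_invF axis_inj).
exists (fun k => (b (inv k)).2) => z [eps _ <-] k.
rewrite summxE (bigD1 (inv k))//= big1 ?addr0; last first.
  move=> i ik; rewrite !mxE /=.
  have -> : (k == (b i).1) = false.
    apply/eqP => kb; move/eqP: ik; apply; apply: (axis_inj) => /=.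
    by rewrite invK -kb.
  by rewrite !mulr0.
rewrite !mxE invK !eqxx /= mulr1.
by case: (eps _); rewrite ?mul1r ?mul0r; [right|left].
Qed.

(** * The cost of climbing *)

Section slowdown.
Context (R : realType) (d : nat) (P : probability (env R d) R).
Hypotheses (iidP : iid P) (ellP : elliptic P).
Implicit Types (w : env R d) (x y z : lattice d.+1) (e f : direction d.+1).

Lemma mean_trans_gt0 x e : 0 < mean P (fun w => trans w x e).
Proof.
have bt : bounded_mfun (fun w : env R d => trans w x e).
  by apply: (@env_poly_bounded_mfun _ _ setT); exact: env_poly_trans.
rewrite lt0r; apply/andP; split; last first.
  by apply: Rintegral_ge0 => w _; exact: trans_ge0.
apply/eqP => m0.
have int0 : (\int[P]_w `|(trans w x e)%:E| = 0)%E.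
  rewrite -[RHS](congr1 EFin m0) EFin_mean//; apply: eq_integral => w _.
  by rewrite gee0_abs// lee_fin trans_ge0.
have mt : measurable_fun setT (fun w : env R d => (trans w x e)%:E).
  by apply/measurable_EFinP; exact: measurable_trans.
have /(ae_eq_integral_abs P measurableT mt) ae0 := int0.
have PT : (0%R < P setT)%E by rewrite (_ : P setT = 1%E)//; exact: probability_setT.
have [w [tw0 tw]] := @filter_ex _ _ (ae_properfilter_algebraOfSetsType PT) _
  (filterI ae0 ellP).
have := tw x e; have [->] := tw0 I; by rewrite ltxx.
Qed.

Context (u : direction d.+1) (s : R) (s0 : 0 <= s) (s1 : s <= 1).

(** Steps change the level by at most 1, so a walk that starts at or below level
    a leaves the region below a exactly at level a. *)
Lemma discounted_exit_le_boundary a (g1 g2 : lattice d.+1 -> env R d -> R) N x w :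
  level u x <= a -> (forall y, level u y = a -> g1 y w <= g2 y w) ->
  discounted_exit s (below u a) g1 N x w <=
  discounted_exit s (below u a) g2 N x w.
Proof.
move=> xa g12; elim: N x xa => [|N IH] x xa /=; rewrite mem_below;
  case: ltP => // ax; try by apply: g12; apply/eqP; rewrite eq_le xa.
rewrite ler_wpM2l//; apply: step_mean_le => e; apply: IH.
by rewrite levelD; have := level_vec_le1 u e; lia.
Qed.

(** When the walk first reaches level a, the environment at levels >= a is still
    independent of everything the walk has used.  The factor psi collects the
    transition probabilities of the steps already made, which is what the
    induction on N needs. *)
Lemma mean_discounted_exit_fresh a (g : lattice d.+1 -> env R d -> R) phi :
  (forall y, env_poly [set z | level u y <= level u z] (g y)) ->
  (forall y, mean P (g y) = phi) ->
  forall N x psi, env_poly (below u a) psi ->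
  mean P (fun w => psi w * discounted_exit s (below u a) g N x w) =
  phi * mean P (fun w => psi w * discounted_exit s (below u a) (fun _ _ => 1) N x w).
Proof.
move=> gpoly gphi N.
have gpolyT y : env_poly setT (g y) by exact: env_poly_sub (gpoly y).
have exit_case x psi : env_poly (below u a) psi -> a <= level u x ->
    mean P (fun w => psi w * g x w) = phi * mean P (fun w => psi w * 1).
  move=> psip ax; rewrite (mean_env_polyM iidP psip (gpoly x)).
    by rewrite gphi mulrC; under [in RHS]eq_fun do rewrite mulr1.
  apply/seteqP; split => z //= -[]; rewrite /below /= => za xz; lia.
elim: N => [|N IH] x psi psip /=; rewrite mem_below; case: ltP => ax;
  try exact: exit_case.
  by under eq_fun do rewrite mulr0; rewrite mean_cst mulr0.
have E (h : lattice d.+1 -> env R d -> R) : (forall y, env_poly setT (h y)) ->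
    mean P (fun w => psi w * (s * step_mean w x (fun y => h y w))) =
    \sum_e s * mean P (fun w => (psi w * trans w x e) * h (x + vec_of e) w).
  move=> hp.
  have hb e : bounded_mfun (fun w => psi w * trans w x e * h (x + vec_of e) w).
    apply: (@env_poly_bounded_mfun _ _ setT); apply: env_polyM => //.
    apply: env_polyM; first exact: env_poly_sub psip.
    exact: env_poly_trans.
  rewrite -mulr_sumr -(mean_sum P _ hb).1 -meanZ; last exact: (mean_sum P _ hb).2.
  congr mean; apply/funext => w; rewrite /step_mean mulrCA; congr (_ * _).
  by rewrite mulr_sumr; apply: eq_bigr => e _; rewrite mulrA.
rewrite !E; last 2 first.
- by move=> y; apply: env_poly_discounted_exit => z; exact: env_poly_cst.
- by move=> y; exact: env_poly_discounted_exit.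
rewrite mulr_sumr; apply: eq_bigr => e _; rewrite mulrCA; congr (_ * _).
by apply: IH; apply: env_polyM => //; exact: env_poly_trans.
Qed.

Context (H : set (lattice d.+1)) (sg : 'I_d.+1 -> bool).
Hypothesis cubeH : forall z, H z -> forall k,
  z 0 k = 0 \/ z 0 k = (-1) ^+ (sg k).
Context (x0 : lattice d.+1) (Hx0 : H x0) (f : direction d.+1).
Hypothesis fu : f.1 != u.1.
Hypothesis entrance : forall z, z 0 f.1 = (x0 - vec_of f) 0 f.1 -> ~ H z.

(* The translate of H that the steps u and f from y enter at the image of x0. *)
Let corner y := y + vec_of u + vec_of f - x0.

Let cube y : set (lattice d.+1) := [set z | H (z - corner y)].

Let mem_cube y z : (corner y + z \in cube y) = (z \in H).
Proof. by apply/idP/idP; rewrite !inE /cube /= addrAC subrr add0r. Qed.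

Let level_cube y z : cube y z -> level u y <= level u z < level u y + 3.
Proof.
move=> Hz; have := cube_level_diff cubeH u Hx0 Hz.
rewrite /corner !(levelD, levelN) level_self level_vec.
rewrite (negbTE (_ : u.1 != f.1)) 1?eq_sym//; lia.
Qed.

(* An upper bound for the discounted time of climbing three levels from y that
   only involves the environment at the level of y and above. *)
Let delay M y w := 1 - (1 - s) * (trans w y u * trans w (y + vec_of u) f *
  \sum_(t < M) s ^+ t * stay (cube y) t (y + vec_of u + vec_of f) w).

(** The annealed mean of delay, which does not depend on the starting point. *)
Definition mean_delay M : R := 1 - (1 - s) *
  (mean P (fun w => trans w 0 u) * mean P (fun w => trans w 0 f) *
   \sum_(t < M) s ^+ t * mean P (stay H t x0)).

Let env_poly_delay M y : env_poly [set z | level u y <= level u z] (delay M y).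
Proof.
apply: env_polyB; first exact: env_poly_cst.
apply: env_polyM; first exact: env_poly_cst.
apply: env_polyM; first apply: env_polyM.
- by apply: env_poly_trans => /=.
- by apply: env_poly_trans => /=; rewrite levelD level_self; lia.
- apply: env_poly_sum => t.
  apply: env_polyM; first exact: env_poly_cst.
  by apply: env_poly_stay => z /level_cube /andP[].
Qed.

(* The sites y, y + u and those of the cube are distinct, so the factors of
   delay are independent. *)
Let mean_delayE M y : mean P (delay M y) = mean_delay M.
Proof.
have tE z e : mean P (fun w => trans w z e) = mean P (fun w => trans w 0 e).
  rewrite -(mean_env_poly_shift iidP z (@env_poly_trans R d setT 0 e I)).
  by congr mean; apply/funext => w; rewrite /trans /shift_env addr0.
have yu : y <> y + vec_of u.
  by move=> /(congr1 (level u)); rewrite levelD level_self; lia.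
have yC z : (z = y \/ z = y + vec_of u) -> ~ cube y z.
  move=> zy; apply: entrance; rewrite /corner.
  case: zy => ->; rewrite /vec_of !mxE (negbTE fu) andbF mulr0.
    by ring.
  by ring.
pose Z t w := stay (cube y) t (y + vec_of u + vec_of f) w.
pose S w := \sum_(t < M) s ^+ t * Z t w.
have Zp t : env_poly (cube y) (Z t).
  exact: (@env_poly_stay _ _ (cube y) (cube y) t).
have Sp : env_poly (cube y) S.
  apply: env_poly_sum => t; apply: env_polyM => //; exact: env_poly_cst.
have Zm t : mean P (Z t) = mean P (stay H t x0).
  have Hp : env_poly H (stay H t x0 : env R d -> R).
    exact: (@env_poly_stay _ _ H H t).
  rewrite -(mean_env_poly_shift iidP (corner y) Hp).
  congr mean; apply/funext => w; rewrite -(stay_shift t x0 w (mem_cube y)).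
  by rewrite /Z /corner subrK.
have Sm : mean P S = \sum_(t < M) s ^+ t * mean P (stay H t x0).
  rewrite (mean_sum P _ _).1; last first.
    by move=> t; exact/bounded_mfunZ/env_poly_bounded_mfun/Zp.
  apply: eq_bigr => t _; rewrite meanZ ?Zm//.
  exact/env_poly_bounded_mfun/Zp.
have p1 : env_poly [set y] (fun w => trans w y u) by exact: env_poly_trans.
have p2 : env_poly [set y + vec_of u] (fun w => trans w (y + vec_of u) f).
  exact: env_poly_trans.
have p12 : env_poly [set z | z = y \/ z = y + vec_of u]
    (fun w => trans w y u * trans w (y + vec_of u) f).
  by apply: env_polyM; apply: env_poly_trans; [left|right].
have pb D h : env_poly D h -> bounded_mfun h by exact: env_poly_bounded_mfun.
have pall : env_poly setT (fun w => trans w y u * trans w (y + vec_of u) f * S w).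
  by apply: env_polyM; [exact: env_poly_sub p12|exact: env_poly_sub Sp].
rewrite /delay (_ : (fun w => _) = fun w =>
    1 + (- (1 - s)) * (trans w y u * trans w (y + vec_of u) f * S w)); last first.
  by apply/funext => w; rewrite mulNr.
rewrite meanD; last 2 first.
- exact/pb/(env_poly_cst setT).
- exact/bounded_mfunZ/pb/pall.
rewrite mean_cst meanZ; last exact/pb/pall.
rewrite mulNr /mean_delay; congr (_ - _ * _).
rewrite (mean_env_polyM iidP p12 Sp); last first.
  by apply/seteqP; split => z //= -[/yC].
rewrite (mean_env_polyM iidP p1 p2) ?Sm ?tE//.
by apply/seteqP; split => z //= -[->].
Qed.

Let exit_disc_delay M N y w :
  discounted_exit s (below u (level u y + 3)) (fun _ _ => 1) N y w <= delay M y w.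
Proof.
apply: exit_disc_trap2 => //.
- by move=> z /level_cube /andP[_].
- by rewrite mem_below; lia.
- by rewrite mem_below levelD level_self; lia.
Qed.

Let bounded_exit_disc (a : int) N x :
  bounded_mfun (discounted_exit s (below u a) (fun _ (_ : env R d) => 1) N x).
Proof.
apply: (@env_poly_bounded_mfun _ _ setT); apply: env_poly_discounted_exit => y.
exact: env_poly_cst.
Qed.

Let bounded_delay M y : bounded_mfun (delay M y).
Proof. exact: env_poly_bounded_mfun (env_poly_delay M y). Qed.

Lemma mean_delay_ge0 M : 0 <= mean_delay M.
Proof.
rewrite -(mean_delayE M 0); apply: Rintegral_ge0 => w _.
apply: (le_trans _ (exit_disc_delay M 0 0 w)); exact: exit_disc_ge0.
Qed.

(** Each passage of three further levels costs an independent factor, because the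
    bound delay at the new starting point only uses fresh sites. *)
Lemma mean_exit_disc_le M N (k : nat) :
  mean P (discounted_exit s (below u (3 * k)%N) (fun _ _ => 1) N 0) <=
  mean_delay M ^+ k.
Proof.
elim: k => [|k IH].
  rewrite expr0 -[leRHS](mean_cst P 1); apply: mean_le => //.
    exact: env_poly_bounded_mfun (env_poly_cst setT _).
  by move=> w; exact: exit_disc_le1.
pose A := below u (3 * k)%N.
have gT y : env_poly setT (delay M y) by exact: env_poly_sub (env_poly_delay M y).
have bD : bounded_mfun (discounted_exit s A (delay M) N 0).
  exact: env_poly_bounded_mfun (env_poly_discounted_exit _ _ _ _ gT).
apply: (@le_trans _ _ (mean P (discounted_exit s A (delay M) N 0))).
  apply: mean_le => // w.
  have AB : A `<=` below u (3 * k.+1)%N.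
    by move=> z; rewrite /A /below /=; lia.
  apply: (le_trans (exit_disc_strong_markov s0 N 0 w AB)).
  apply: discounted_exit_le_boundary.
    by rewrite /level mxE mulr0; lia.
  move=> y ya; have -> : ((3 * k.+1)%N : int) = level u y + 3 by lia.
  exact: exit_disc_delay.
have := mean_discounted_exit_fresh (env_poly_delay M) (mean_delayE M) N 0
  (env_poly_cst (below u (3 * k)%N) 1).
under eq_fun do rewrite mul1r.
under [in RHS]eq_fun do rewrite mul1r.
move=> ->; rewrite exprS ler_wpM2l//; exact: mean_delay_ge0.
Qed.

Lemma mean_exit_le M N (k : nat) :
  s ^+ N * (1 - mean P (stay (below u (3 * k)%N) N 0)) <= mean_delay M ^+ k.
Proof.
have bs : bounded_mfun (stay (below u (3 * k)%N) N 0 : env R d -> R).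
  apply: (@env_poly_bounded_mfun _ _ setT); exact: env_poly_stay.
have b1 r : bounded_mfun (fun _ : env R d => r).
  exact: env_poly_bounded_mfun (env_poly_cst setT _).
apply: (le_trans _ (mean_exit_disc_le M N k)).
have -> : s ^+ N * (1 - mean P (stay (below u (3 * k)%N) N 0)) =
    mean P (fun w => s ^+ N + (- s ^+ N) * stay (below u (3 * k)%N) N 0 w).
  rewrite meanD//; last exact: bounded_mfunZ.
  by rewrite mean_cst meanZ// mulrBr mulr1 mulNr.
apply: mean_le => //; first by apply: bounded_mfunD => //; exact: bounded_mfunZ.
move=> w; apply: (le_trans _ (stay_exit_disc _ _ _ _ s0 s1)).
by rewrite mulNr mulrBr mulr1.
Qed.

End slowdown.

(** * From discounted means to zero velocity *)

Lemma partial_sums_unbounded (R : realType) (a : nat -> R) (K : R) :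
  (\sum_(0 <= t <oo) (a t)%:E = +oo)%E -> (forall t, 0 <= a t) ->
  exists M, K < \sum_(t < M) a t.
Proof.
move=> aoo a0; apply: contrapT => /forallNP noM.
have : (\sum_(0 <= t <oo) (a t)%:E <= K%:E)%E.
  apply: lime_le; first by apply: is_cvg_nneseries => t _ _; rewrite lee_fin.
  apply: nearW => M /=; rewrite big_mkord sumEFin lee_fin leNgt.
  exact/negP/noM.
by rewrite aoo.
Qed.

Lemma fsbig_max_eq_pinfty (R : realType) (I : choiceType) (D : set I)
    (F : I -> \bar R) :
  (\big[maxe/-oo]_(i \in D) F i = +oo)%E -> exists2 i, D i & F i = +oo%E.
Proof.
move=> H; apply: contrapT => noi.
suff : (\big[maxe/-oo]_(i \in D) F i < +oo)%E by rewrite H ltxx.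
have [fin|inf] := pselect (finite_set (D `&` F @^-1` [set~ -oo%E])); last first.
  by rewrite no_finite_support// big_nil.
rewrite big_seq; elim/big_ind : _ => //.
  by move=> a b ha hb; rewrite gt_max ha hb.
move=> i; rewrite in_finite_support// inE => -[Di _].
by rewrite ltey; apply/eqP => Fi; apply: noi; exists i.
Qed.
Lemma bernoulli_inequality (R : realDomainType) (x : R) (m : nat) : 0 <= x <= 1 ->
  1 - m%:R * x <= (1 - x) ^+ m.
Proof.
move=> /andP[x0 x1]; elim: m => [|m IH]; first by rewrite mul0r subr0 expr0.
rewrite exprS; apply: (@le_trans _ _ ((1 - x) * (1 - m%:R * x))).
  rewrite -natr1 mulrDl mul1r; have : 0 <= m%:R * x * x by rewrite !mulr_ge0.
  move: (m%:R * x) => y; nra.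
by rewrite ler_wpM2l// subr_ge0.
Qed.

(** With s = 1 - delta, the left-hand side is 1 - delta * (weighted sum) while
    s ^ C >= 1 - C * delta; a divergent sum exceeds C after discounting, provided
    that delta is small compared with 1 / M. *)
Lemma discount_beats_power (R : realType) (a : nat -> R) (kappa : R) (C : nat) :
  0 < kappa -> (forall t, 0 <= a t) ->
  (forall K, exists M, K < \sum_(t < M) a t) ->
  exists s M, [/\ 0 < s, s <= 1 &
    1 - (1 - s) * (kappa * \sum_(t < M) s ^+ t * a t) < s ^+ C].
Proof.
move=> k0 a0 unb; have [M hM] := unb (2 * C%:R / kappa).
pose delta : R := (2 * M.+1%:R)^-1.
have M1 : (1 : R) <= M.+1%:R by rewrite ler1n.
have d0 : 0 < delta by rewrite invr_gt0 mulr_gt0.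
have d2 : delta * (2 * M.+1%:R) = 1 by rewrite mulVf// mulf_neq0// pnatr_eq0.
have d1 : delta <= 2^-1.
  rewrite /delta lef_pV2 ?posrE ?mulr_gt0// ler_peMr//.
(* This delta keeps s ^ t >= 1 / 2 for all t < M; the bound 2 * C / kappa on the
   partial sum makes up for that factor. *)
exists (1 - delta), M; split; [lra|lra|].
have half (t : 'I_M) : 2^-1 <= (1 - delta) ^+ t.
  apply: le_trans (@bernoulli_inequality _ delta t _); last by apply/andP; split; lra.
  have tM : (t%:R : R) <= M.+1%:R by rewrite ler_nat ltnW// ltnS ltnW.
  have : t%:R * delta <= M.+1%:R * delta by rewrite ler_wpM2r// ltW.
  lra.
have S1 : C%:R < kappa * \sum_(t < M) (1 - delta) ^+ t * a t.
  apply: (@lt_le_trans _ _ (kappa * (2^-1 * \sum_(t < M) a t))).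
    move: hM; rewrite ltr_pdivrMr// mulrC; lra.
  rewrite ler_wpM2l//; first exact: ltW.
  rewrite mulr_sumr; apply: ler_sum => t _; exact: ler_wpM2r.
apply: lt_le_trans (@bernoulli_inequality _ delta C _); last by apply/andP; split; lra.
rewrite opprB addrCA subrr addr0 mulrC ltrD2l ltrN2 ltr_pM2r//.
Qed.

Section almost_sure.
Context (R : realType) (d : nat).

Lemma ae_eventually_geometric (d' : measure_display) (T : measurableType d')
    (mu : {measure set T -> \bar R})
    (F : nat -> set T) (q : R) : 0 <= q -> q < 1 ->
  (forall k, measurable (F k)) -> (forall k, (mu (F k) <= (q ^+ k)%:E)%E) ->
  {ae mu, forall t, exists K, forall k, (K <= k)%N -> ~ F k t}.
Proof.
move=> q0 q1 mF Fq.
have sumF : (\sum_(k <oo) mu (F k) < +oo)%E.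
  apply: (@le_lt_trans _ _ ((1 - q)^-1)%:E%E); last by rewrite ltry.
  apply: lime_le; first by apply: is_cvg_nneseries.
  apply: nearW => n /=; apply: (@le_trans _ _ (\sum_(0 <= k < n) (q ^+ k)%:E)%E).
    by apply: lee_sum.
  rewrite big_mkord sumEFin lee_fin -[leRHS]mul1r ler_pdivlMr ?subr_gt0//.
  by rewrite mulrC -opprB mulNr -subrX1 opprB gerBl exprn_ge0.
have := lim_sup_set_cvg0 mF sumF => lim0.
exists (lim_sup_set F); split => //.
  by apply: bigcap_measurableType => k _; exact: bigcup_measurable.
move=> t /= /forallNP H N _; have /existsNP[k] := H N.
by move=> /not_implyP[Nk /contrapT Fk]; exists k.
Qed.

(** The bounds for u and - u control the absolute value of a coordinate; at time
    n one takes k = n / C + 1, so that 3 k / n is about 3 / C. *)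
Lemma vanishing_velocity (X : nat -> lattice d.+1) :
  (forall (u : direction d.+1) (C : nat), exists K, forall k, (K <= k)%N ->
     forall j, (j <= C * k)%N -> level u (X j) < (3 * k)%N) ->
  (k%:R^-1 *: realvec R (X k)) @[k --> \oo] --> (0 : 'rV[R]_d.+1).
Proof.
move=> slow; apply/cvgrPdist_lt => e e0.
(* With 6 / e < C <= n, both terms of 3 * (n / C) + 3 are at most e * n / 2. *)
pose C := (Num.truncn (6 / e)).+1.
have Ce : 6 / e < C%:R by exact: truncnS_gt.
have C0 : (0 < C)%N by [].
have all_u : \forall n \near \oo, forall u : direction d.+1,
    (level u (X n))%:~R < e * n%:R :> R.
  apply: filter_forall => u; have [K hK] := slow u C.
  near=> n.
  have nC : (C <= n)%N by near: n; exact: nbhs_infty_ge.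
  have nK : (C * K <= n)%N by near: n; exact: nbhs_infty_ge.
  pose k := (n %/ C).+1.
  have Kk : (K <= k)%N by rewrite /k ltnW// ltnS leq_divRL// mulnC.
  have nk : (n <= C * k)%N by rewrite /k mulnC ltnW// ltn_ceil.
  have := hK k Kk n nk; rewrite -(ltr_int R) => /lt_le_trans; apply.
  have kC : (n %/ C)%:R * C%:R <= n%:R :> R by rewrite -natrM ler_nat leq_trunc_div.
  have CR : 6 < C%:R * e by rewrite -ltr_pdivrMr.
  have Cn : C%:R <= n%:R :> R by rewrite ler_nat.
  have -> : ((3 * k)%N : int)%:~R = 3 * (n %/ C)%:R + 3 :> R.
    have kR : k%:R = (n %/ C)%:R + 1 :> R by rewrite natr1.
    by rewrite -pmulrn natrM kR mulrDr mulr1.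
  have h1 : 6 * (n %/ C)%:R <= e * n%:R.
    apply: (@le_trans _ _ (C%:R * e * (n %/ C)%:R)).
      by rewrite ler_wpM2r// ltW.
    by rewrite mulrAC [leRHS]mulrC ler_wpM2r ?(ltW e0)// mulrC.
  have h2 : 6 <= e * n%:R.
    by rewrite (le_trans (ltW CR))// mulrC ler_wpM2l// ltW.
  lra.
near=> n.
have n0 : (0 < n)%N by near: n; exact: nbhs_infty_gt.
have nu : forall u : direction d.+1, (level u (X n))%:~R < e * n%:R :> R by near: n.
have nR : (0 : R) < n%:R by rewrite ltr0n.
rewrite sub0r normrN /Num.norm /= mx_normrE; apply/bigmax_ltP; split => // -[i j] _.
rewrite /= !mxE normrM ger0_norm ?invr_ge0// mulrC ltr_pdivrMr// ltr_norml.
have := nu (j, false); have := nu (j, true); rewrite /level /= ord1 expr0 expr1.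
rewrite mul1r mulN1r mulrNz => a b; apply/andP; split => //; lra.
Unshelve. all: by end_near.
Qed.
End almost_sure.

(** Borel-Cantelli for the events that level 3 k is reached within C k steps,
    whose probabilities decay geometrically once s and M are chosen for C. *)
Lemma infinite_mean_slows_direction (R : realType) (d : nat)
    (P : probability (env R d) R)
    (Q : lattice d.+1 -> R.-pker (env R d) ~> (traj d.+1))
    (H : set (lattice d.+1)) (sg : 'I_d.+1 -> bool) (x0 : lattice d.+1)
    (u f : direction d.+1) (C : nat) :
  iid P -> elliptic P -> quenched_law Q ->
  (forall z : lattice d.+1, H z -> forall k, z 0 k = 0 \/ z 0 k = (-1) ^+ (sg k)) ->
  H x0 -> f.1 != u.1 ->
  (forall z : lattice d.+1, z 0 f.1 = (x0 - vec_of f) 0 f.1 -> ~ H z) ->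
  (\int[annealed P (Q x0)]_X exit_time R H X = +oo)%E ->
  {ae annealed P (Q 0), forall X : traj d.+1, exists K, forall k, (K <= k)%N ->
     forall j, (j <= C * k)%N -> level u (X j) < (3 * k)%N}.
Proof.
move=> iidP ellP QP cubeH Hx0 fu entrance; rewrite (integral_exit_time P QP) => inf.
pose a t := mean P (stay H t x0).
have a0 t : 0 <= a t by apply: Rintegral_ge0 => w _; exact: stay_ge0.
have kappa0 : 0 < mean P (fun w => trans w 0 u) * mean P (fun w => trans w 0 f).
  by rewrite mulr_gt0// mean_trans_gt0.
have [s [M [s0 s1 hs]]] := discount_beats_power C kappa0 a0
  (fun K => partial_sums_unbounded K inf a0).
pose phi := mean_delay P u s H x0 f M.
have phi0 : 0 <= phi by exact: (mean_delay_ge0 iidP (ltW s0) s1 cubeH Hx0 fu entrance).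
have phis : phi < s ^+ C by rewrite /phi /mean_delay.
have sC : 0 < s ^+ C by exact: exprn_gt0.
pose F k := ~` staying (below u (3 * k)%N) (C * k)%N.
have mF k : measurable (F k) by apply: measurableC; exact: measurable_staying.
have Fq k : (annealed P (Q 0%R) (F k) <= ((phi / s ^+ C) ^+ k)%:E)%E.
  have -> : annealed P (Q 0) (F k) =
      (1 - annealed P (Q 0%R) (staying (below u (3 * k)%N) (C * k)%N))%E.
    by apply: probability_setC; exact: measurable_staying.
  rewrite (annealed_staying P QP) -EFinB lee_fin expr_div_n -exprM.
  rewrite ler_pdivlMr ?exprn_gt0// mulrC.
  exact: (mean_exit_le iidP (ltW s0) s1 cubeH Hx0 fu entrance).
have q0 : 0 <= phi / s ^+ C by rewrite divr_ge0// ltW.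
have q1 : phi / s ^+ C < 1 by rewrite ltr_pdivrMr// mul1r.
have := ae_eventually_geometric q0 q1 mF Fq.
apply: filterS => X [K hK]; exists K => k Kk j jC.
have /contrapT := hK k Kk; rewrite /staying /= => /(_ j jC).
by rewrite mem_below.
Qed.

(* The dimension is n.+2; the definitions taking n.+1 live on the lattice
   of dimension n.+2. *)
Theorem theorem3p1 (R : realType) (n : nat)
    (P : probability (env R n.+1) R)
    (Q : lattice n.+2 -> R.-pker (env R n.+1) ~> (traj n.+2))
    (l : 'rV[R]_n.+2) (b : 'I_n.+2 -> direction n.+2) :
  iid P -> elliptic P -> quenched_law Q ->
  dot l l = 1 ->
  transient (annealed P (Q 0)) l ->
  adapted_basis l b ->
  (\big[maxe/-oo]_(x \in hypercube b)
     \int[annealed P (Q x)]_X exit_time R (hypercube b) X = +oo)%E ->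
  {ae annealed P (Q 0), forall X : traj n.+2,
     (k%:R^-1 *: realvec R (X k)) @[k --> \oo] --> (0 : 'rV[R]_n.+2)}.
Proof.
move=> iidP ellP QP _ _ basis /fsbig_max_eq_pinfty[x0 Hx0 inf].
have [sg cubeH] := hypercube_corners basis.
have slow (u : direction n.+2) : {ae annealed P (Q 0), forall X : traj n.+2,
    forall C : nat, exists K, forall k, (K <= k)%N ->
    forall j, (j <= C * k)%N -> level u (X j) < (3 * k)%N}.
  (* The entrance step is sideways: then y and y + u both lie in the hyperplane
     from which it starts, hence outside the translated hypercube. *)
  have [k ku] : exists k : 'I_n.+2, k != u.1.
    have [u0|u0] := eqVneq u.1 ord0; last by exists ord0; rewrite eq_sym.
    by exists ord_max; rewrite u0.
  have [f [fk entrance]] := cube_entrance cubeH k Hx0.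
  rewrite -fk in ku entrance.
  apply: ae_foralln => C.
  exact: (infinite_mean_slows_direction C iidP ellP QP cubeH Hx0 ku entrance inf).
have all_slow : {ae annealed P (Q 0), forall X : traj n.+2,
    forall (u : direction n.+2) (C : nat), exists K, forall k, (K <= k)%N ->
    forall j, (j <= C * k)%N -> level u (X j) < (3 * k)%N}.
  by apply: filter_forall => u; exact: slow.
by apply: filterS all_slow => X slowX; exact: vanishing_velocity.
Qed.
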